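(* Let $n>4$. The flip graph $\Gamma_n$ of colored triangle-free triangulations of a convex $n$-gon (considered without its edge labeling) is isomorphic, as a graph, to the graph of chambers $G_1(U'_n)$.
   Context: Triangulations. Label the vertices of a convex $n$-gon $P_n$ cyclically by the elements $0,1,\ldots,n-1$ of $\mathbb{Z}_n$. Triangulations of $P_n$ have no extra vertices. Edges of the polygon are external edges of the triangulation; all other edges are internal edges, or chords; $[i,j]$ denotes the segment joining vertices $i$ and $j$. A triangulation is triangle-free if it contains no triangle with three internal edges. A chord is short if it connects vertices $i-1$ and $i+1$ for some $i\in\mathbb{Z}_n$; a triangle-free triangulation contains exactly two short chords. A proper coloring of a triangle-free triangulation is a labeling of its $n-3$ chords by $0,\ldots,n-4$ (each label used once) such that one of the short chords is labeled $0$ and, whenever a triangle has exactly two internal edges, their labels are consecutive integers $i,i+1$. $CTFT(n)$ is the set of all properly colored triangle-free triangulations of $P_n$. Each chord is a diagonal of a unique quadrangle (the union of the two adjacent triangles); replacing the chord by the other diagonal of that quadrangle is a flip of the chord; in a colored triangulation the new diagonal receives the label of the flipped one. The colored flip graph $\Gamma_n$ has vertex set $CTFT(n)$; two elements are joined by an edge (labeled $i$) if one is obtained from the other by a flip of the chord labeled $i$. Arc permutations. $S_n$ is the symmetric group on $\{1,\ldots,n\}$; $\pi\in S_n$ is written $[\pi(1),\ldots,\pi(n)]$. The letter $n$ is identified with $0\in\mathbb{Z}_n$. An interval in $\mathbb{Z}_n$ is a subset of the form $\{i,i+1,\ldots,i+k\}$ (addition modulo $n$). A permutation $\pi\in S_n$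 is an arc permutation if for every $1\le k\le n$ the set $\{\pi(1),\ldots,\pi(k)\}$ is an interval in $\mathbb{Z}_n$. $U_n\subset S_n$ is the set of arc permutations. $\tilde K'_n$-equivalence on $U_n$ is the transitive closure of the relation on $\pi,\tau\in U_n$: two letters that are either $j$ and $j+1$ for some $1\le j<n$, or $1$ and $n$, occupy adjacent positions in $\pi$, and $\tau$ is obtained from $\pi$ by switching their positions. $U'_n$ is the set of $\tilde K'_n$-equivalence classes in $U_n$. Arrangements. Let $W=\{\bar x\in\mathbb{R}^n: x_1+\cdots+x_n=0\}$ and $H_{ij}=\{\bar x\in W: x_i=x_j\}$. For $\pi\in S_n$ let $c_\pi=\{\bar x\in W: x_{\pi(1)}<x_{\pi(2)}<\cdots<x_{\pi(n)}\}$; these are the chambers of the reflection arrangement $\{H_{ij}\}_{1\le i<j\le n}$. Let $K'_n$ be the graph obtained from the complete graph on $\{1,\ldots,n\}$ by deleting the edges $\{1,2\},\{2,3\},\ldots,\{n-1,n\},\{n,1\}$, and let $\mathcal{A}'_{n-1}=\mathcal{A}(K'_n)=\{H_{ij}: \{i,j\}\text{ is an edge of }K'_n\}$. Chambers of an arrangement are the connected components of the complement of the union of its hyperplanes; two chambers are adjacent if they are separated by exactly one hyperplane of the arrangement. The graph $G_1(U'_n)$ has vertex set $U'_n$; two classes are adjacent if they have representatives $\pi,\tau\in U_n$ such that $c_\pi$ and $c_\tau$ lie in adjacent chambers of $\mathcal{A}'_{n-1}$. *)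

(* Defs.v *)
From HB Require Import structures.
From mathcomp Require Import all_boot all_order all_algebra all_fingroup.
From mathcomp Require Import all_classical all_reals all_analysis.
Import numFieldNormedType.Exports.

Set Implicit Arguments.
Unset Strict Implicit.
Unset Printing Implicit Defensive.

Local Open Scope nat_scope.

(* A vertex of the polygon is an element of Z_n, represented by 'I_n with the
   cyclic successor [ordS] (i |-> i + 1) and predecessor [ord_pred]; a segment
   [i, j] is the two-element set of its endpoints. *)

Section Polygon.
Variable n : nat.
Implicit Types (e f t : {set 'I_n}) (T : {set {set 'I_n}}).

Definition external_edge e : bool := [exists i : 'I_n, e == [set i; ordS i]].

Definition chord e : bool := (#|e| == 2) && ~~ external_edge e.

(* Two segments cross in an interior point when their endpoints are distinct
   and alternate along the boundary of the polygon. *)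
Definition crossing e f : bool :=
  [exists a : 'I_n, exists b : 'I_n, exists c : 'I_n, exists d : 'I_n,
    [&& a < b, b < c, c < d
      & (e == [set a; c]) && (f == [set b; d])
        || (f == [set a; c]) && (e == [set b; d])]].

Definition noncrossing_chords T : bool :=
  [forall e in T, chord e] && [forall e in T, forall f in T, ~~ crossing e f].

(* A triangulation is given by its set of chords (internal edges). *)
Definition triangulation T : bool := maxset noncrossing_chords T.

(* No chord can enter a triangle whose three sides are edges, so these
   triples are exactly the faces of the triangulation. *)
Definition triangle T t : bool :=
  (#|t| == 3) &&
  [forall i in t, forall j in t,
     (i != j) ==> external_edge [set i; j] || ([set i; j] \in T)].

Definition internal_edges T t : {set {set 'I_n}} := [set e in T | e \subset t].

Definition triangle_free T : bool :=
  ~~ [exists t, triangle T t && (#|internal_edges T t| == 3)].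

Definition short_chord e : bool :=
  chord e && [exists i : 'I_n, e == [set ord_pred i; ordS i]].

(* A colored triangulation is encoded by the inverse of its labeling: [c k] is
   the chord with label k, for 0 <= k <= n - 4. *)
Definition coloring := {ffun 'I_(n - 3) -> {set 'I_n}}.
Implicit Types c d : coloring.

Definition chords_of c : {set {set 'I_n}} := [set c k | k : 'I_(n - 3)].

Definition proper_coloring c : bool :=
  [&& injectiveb c,
      [exists k : 'I_(n - 3), (k == 0 :> nat) && short_chord (c k)]
    & [forall t, triangle (chords_of c) t ==>
        (#|internal_edges (chords_of c) t| == 2) ==>
        [forall k : 'I_(n - 3), forall l : 'I_(n - 3),
          [&& k != l, c k \subset t & c l \subset t] ==>
          (l == k.+1 :> nat) || (k == l.+1 :> nat)]]].

Definition CTFT : {set coloring} :=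
  [set c | [&& triangulation (chords_of c), triangle_free (chords_of c)
             & proper_coloring c]].

(* The union t1 :|: t2 of the two triangles adjacent to the chord [c i] is the
   vertex set of the quadrangle; removing the endpoints of [c i] leaves those
   of the other diagonal. *)
Definition flip (i : 'I_(n - 3)) c d : bool :=
  [exists t1, exists t2,
    [&& t1 != t2, triangle (chords_of c) t1, triangle (chords_of c) t2,
        c i \subset t1, c i \subset t2
      & d == [ffun k => if k == i then (t1 :|: t2) :\: c i else c k]]].

Definition flip_vertex := {c : coloring | c \in CTFT}.

Definition flip_graph (x y : flip_vertex) : Prop :=
  exists i, flip i (val x) (val y) || flip i (val y) (val x).

End Polygon.

(* The letter a + 1 of {1, ..., n} is represented by a : 'I_n, and similarly
   for positions. Hence [ordS a] is the residue modulo n of that letter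
   (n being identified with 0), and two letters are cyclically adjacent when
   they are j, j + 1 for some 1 <= j < n, or 1 and n. *)

Section ArcPermutations.
Variable n : nat.

Definition cyclic_interval (A : {set 'I_n}) : bool :=
  [exists i : 'I_n, exists k : 'I_n,
     A == [set iter m (@ordS n) i | m : 'I_n & m <= k]].

Definition arc_perms : {set 'S_n} :=
  [set pi : 'S_n |
    [forall k : 'I_n, cyclic_interval [set ordS (pi m) | m : 'I_n & m <= k]]].

Definition cyclically_adjacent (a b : 'I_n) : bool :=
  (b == ordS a) || (a == ordS b).

(* In mathcomp (tperm p q * pi) m = pi (tperm p q m). *)
Definition switch (pi tau : 'S_n) : bool :=
  [&& pi \in arc_perms, tau \in arc_perms
    & [exists p : 'I_n, exists q : 'I_n,
        [&& q == p.+1 :> nat, cyclically_adjacent (pi p) (pi q)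
          & tau == (tperm p q * pi)%g]]].

Definition arc_classes : {set {set 'S_n}} :=
  equivalence_partition (connect switch) arc_perms.

Definition class_vertex := {A : {set 'S_n} | A \in arc_classes}.

End ArcPermutations.

Section Arrangement.
Local Open Scope classical_set_scope.
Local Open Scope ring_scope.
Variables (R : realType) (n : nat).
Implicit Types (C D H : set 'rV[R]_n).

Definition sum_zero : set 'rV[R]_n := [set x | \sum_(i < n) x 0 i = 0]%classic.

Definition hyperplane (i j : 'I_n) : set 'rV[R]_n :=
  [set x | sum_zero x /\ x 0 i = x 0 j]%classic.

Definition half_space (i j : 'I_n) : set 'rV[R]_n :=
  [set x | sum_zero x /\ x 0 i < x 0 j]%classic.

Definition cone (pi : 'S_n) : set 'rV[R]_n :=
  [set x | sum_zero x /\
    forall k l : 'I_n, (k < l)%N -> x 0 (pi k) < x 0 (pi l)]%classic.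

Definition K'_edge (i j : 'I_n) : bool :=
  (i != j) && ~~ cyclically_adjacent i j.

Definition arrangement : set (set 'rV[R]_n) :=
  [set H | exists i j, K'_edge i j /\ H = hyperplane i j]%classic.

Definition arrangement_complement : set 'rV[R]_n :=
  [set x | sum_zero x /\ forall H, arrangement H -> ~ H x]%classic.

Definition chamber C : Prop :=
  exists2 x, arrangement_complement x &
    C = connected_component arrangement_complement x.

Definition separates H C D : Prop :=
  exists i j, [/\ H = hyperplane i j, C `<=` half_space i j
                & D `<=` half_space j i].

Definition adjacent_chambers C D : Prop :=
  exists! H, arrangement H /\ separates H C D.

Definition lie_in_adjacent_chambers (pi tau : 'S_n) : Prop :=
  exists C D, [/\ chamber C, chamber D, cone pi `<=` C, cone tau `<=` D
                & adjacent_chambers C D].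

Definition chamber_graph (A B : class_vertex n) : Prop :=
  exists pi tau, [/\ pi \in val A, tau \in val B
                   & lie_in_adjacent_chambers pi tau].

End Arrangement.

Definition graph_isomorphic (V1 V2 : Type)
    (E1 : V1 -> V1 -> Prop) (E2 : V2 -> V2 -> Prop) : Prop :=
  exists f : V1 -> V2, bijective f /\ forall x y, E1 x y <-> E2 (f x) (f y).

(* Main.v *)
Require Import Defs.
From mathcomp Require Import all_boot all_order all_algebra all_fingroup.
From mathcomp Require Import all_classical all_reals all_analysis.
From mathcomp Require Import zify ring lra.

(** Both graphs are isomorphic to the same elementary one. Its vertices are the
    chains of [n - 3] cyclic intervals in which each interval extends the
    previous one by a single element at either end; two chains are adjacent when
    they differ in exactly one member. A chain is encoded by the sequence of the
    first elements of its members, here called a staircase.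

    On the side of triangulations, the chord labeled [k] cuts off [k.+1] vertices,
    and these sets of vertices form a chain. Indeed the short chord labeled [0]
    starts it, and the triangle beyond the chord labeled [k] has exactly one
    further internal edge, which by properness carries the label [k.+1]
    ([next_label], [CTFT_stair]). Conversely, the diagonals of a chain are
    pairwise noncrossing, no chord can be added ([stair_saturated]), and any two
    of them in a common triangle have consecutive labels, which gives properness
    and excludes triangles with three internal edges ([stair_CTFT]). A flip
    replaces one diagonal; it leads to another chain exactly when the
    neighbours of this diagonal leave a choice ([flip_differ_once],
    [differ_once_flip]).

    On the side of permutations, the first letters of an arc permutation form
    intervals that grow by one. Switching two cyclically adjacent letters at
    neighbouring places keeps this property only at the first two or the last
    two places, so a class remembers precisely the intervals of sizes from [2]
    to [n - 2]: again a chain ([follows_connect], [connect_follows]). The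
    chamber that contains [c_pi] is determined by the order in which [pi] lists
    the endpoints of the edges of [K'_n] ([component_cell], [cone_cell]), hence
    two cones lie in adjacent chambers if and only if exactly one edge of [K'_n]
    is listed in opposite orders ([lie_in_adjacent_chambersP]). If two chains
    differ in one member, representatives that agree elsewhere have this
    property ([differ_once_realize]). Conversely, each member in which the
    chains differ exhibits a pair of nonadjacent letters in opposite order, and
    the same pair cannot serve two members ([single_inversion_differ]). *)

Set Implicit Arguments.
Unset Strict Implicit.
Unset Printing Implicit Defensive.

Local Open Scope nat_scope.


(** * Offsets on the circle of vertices *)

Definition turn {n} (a : 'I_n) (m : nat) : 'I_n := iter m (@ordS n) a.

Arguments turn : simpl never.

Definition off {n} (a b : 'I_n) : nat := if a <= b then b - a else b + n - a.

Lemma off_spec n (a b : 'I_n) :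
  a <= b /\ off a b = b - a \/ b < a /\ off a b = b + n - a.
Proof. by rewrite /off; case: leqP; [left|right]. Qed.

Lemma ordS_spec n (a : 'I_n) :
  a.+1 < n /\ ordS a = a.+1 :> nat \/ a.+1 = n /\ ordS a = 0 :> nat.
Proof.
have := ltn_ord a; rewrite leq_eqVlt => /orP[/eqP e|lt_a] /=; [right|left].
  by rewrite {1 2}e modnn.
by rewrite modn_small.
Qed.

Lemma turn_mod n (a : 'I_n) m : turn a m = (a + m) %% n :> nat.
Proof.
elim: m => [|m IH]; first by rewrite addn0 modn_small.
by rewrite /turn iterS /= -/(turn a m) IH -addn1 modnDml addn1 addnS.
Qed.

Lemma turn_spec n (a : 'I_n) m :
  m <= n -> a + m < n /\ turn a m = a + m :> nat \/ turn a m + n = a + m.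
Proof.
move=> le_mn; have lt_an := ltn_ord a.
rewrite turn_mod; case: (ltnP (a + m) n) => h; first by left; rewrite modn_small.
right; rewrite -(subnK h) modnDr modn_small //; lia.
Qed.

Ltac add_fact t :=
  let T := type of t in
  lazymatch goal with H : T |- _ => fail | _ => pose proof t end.

Ltac circ_facts := repeat match goal with
  | |- context[off ?a ?b] => add_fact (off_spec a b)
  | H : context[off ?a ?b] |- _ => add_fact (off_spec a b)
  | |- context[turn ?a ?b] => add_fact (turn_spec a (m := b))
  | H : context[turn ?a ?b] |- _ => add_fact (turn_spec a (m := b))
  | |- context[ordS ?a] => add_fact (ordS_spec a)
  | H : context[ordS ?a] |- _ => add_fact (ordS_spec a)
  | |- context[nat_of_ord ?a] => add_fact (ltn_ord a)
  | H : context[nat_of_ord ?a] |- _ => add_fact (ltn_ord a)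
  end.

Lemma ord_eqE n (a b : 'I_n) : (a == b) = (a == b :> nat).
Proof. by []. Qed.

Lemma ord_eqP_val n (a b : 'I_n) : (a = b) = (a = b :> nat).
Proof. by apply: propext; split=> [->//|]; apply: ord_inj. Qed.

(** Linear arithmetic modulo [n]: every turn, offset and successor in sight is
    replaced by its value with or without wrapping around. *)
Ltac circ := intros;
  repeat match goal with
  | H : _ |- _ => rewrite !ord_eqP_val in H
  | H : _ |- _ => rewrite !ord_eqE in H
  end; rewrite ?ord_eqP_val ?ord_eqE; circ_facts; lia.

Section Circle.
Variable n : nat.
Implicit Types a b c p q r s : 'I_n.

Lemma off_lt a b : off a b < n. Proof. circ. Qed.

Lemma off_turn a m : m < n -> off a (turn a m) = m. Proof. move=> h; circ. Qed.

Lemma turn_inj a m k : m < n -> k < n -> turn a m = turn a k -> m = k.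
Proof. move=> hm hk h; circ. Qed.

Lemma off_inj a : injective (off a).
Proof. move=> b c h; circ. Qed.

Lemma set2_eq (T : finType) (a b c d : T) :
  [set a; b]%SET = [set c; d]%SET -> (a = c /\ b = d) \/ (a = d /\ b = c).
Proof.
move=> e.
have: a \in [set c; d]%SET by rewrite -e set21.
have: b \in [set c; d]%SET by rewrite -e set22.
have: c \in [set a; b]%SET by rewrite e set21.
have: d \in [set a; b]%SET by rewrite e set22.
rewrite !inE.
by do 4![case/orP=> /eqP ?]; first [left; split; congruence | right; split; congruence].
Qed.

Lemma crossing_sym (e f : {set 'I_n}) : crossing e f = crossing f e.
Proof.
by rewrite /crossing; do 4![apply: eq_existsb => ?]; rewrite orbC.
Qed.

Lemma crossing_lt p q r s : p < q -> r < s ->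
  crossing [set p; q]%SET [set r; s]%SET = (p < r < q) && (q < s) || (r < p < s) && (s < q).
Proof.
move=> lt_pq lt_rs; apply/idP/idP.
- case/existsP=> a /existsP[b /existsP[c /existsP[d /and4P[ab bc cd]]]].
  by case/orP=> /andP[/eqP/set2_eq e1 /eqP/set2_eq e2];
    case: e1 => -[? ?]; case: e2 => -[? ?]; subst; lia.
- case/orP=> h; apply/existsP.
    exists p; apply/existsP; exists r; apply/existsP; exists q; apply/existsP; exists s.
    by rewrite !eqxx; lia.
  exists r; apply/existsP; exists p; apply/existsP; exists s; apply/existsP; exists q.
  by rewrite !eqxx; lia.
Qed.

(** The pairs [x, y] and [u, v] alternate when exactly one of [u] and [v] lies
    between [x] and [y]. In this parity form a change of origin on the circle
    flips each comparison in a way that cancels out, see [crossing_off]. *)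
Definition alternate (x y u v : nat) : bool :=
  [&& x != u, x != v, y != u, y != v
    & (x < u) (+) (y < u) (+) (x < v) (+) (y < v)].

Lemma alternateE x y u v :
  let btw w := (x < w < y) || (y < w < x) in
  let out w := (w < x) && (w < y) || (x < w) && (y < w) in
  alternate x y u v = btw u && out v || btw v && out u.
Proof.
rewrite /alternate /=.
by case: (ltngtP x u); case: (ltngtP x v); case: (ltngtP y u);
  case: (ltngtP y v) => //= *; lia.
Qed.

Lemma crossing_val p q r s :
  crossing [set p; q]%SET [set r; s]%SET = alternate p q r s.
Proof.
rewrite alternateE.
wlog le_pq : p q / p <= q.
  move=> W; case: (leqP p q) => [|/ltnW] h; first exact: W.
  by rewrite finset.setUC W // /alternate; lia.
wlog le_rs : r s / r <= s.
  move=> W; case: (leqP r s) => [|/ltnW] h; first exact: W.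
  by rewrite (finset.setUC [set r]%SET) W // /alternate; lia.
have no x c d : ~~ crossing [set x; x]%SET [set c; d]%SET.
  apply/negP; case/existsP=> a /existsP[b /existsP[c' /existsP[d' /and4P[ab bc cd]]]].
  by case/orP=> /andP[/eqP/set2_eq e1 /eqP/set2_eq e2];
    case: e1 => -[? ?]; case: e2 => -[? ?]; subst; lia.
case: (ltngtP p q) => lt_pq; first last.
- by rewrite (val_inj lt_pq) (negbTE (no _ _ _)) /alternate; lia.
- lia.
case: (ltngtP r s) => lt_rs; first last.
- rewrite crossing_sym (val_inj lt_rs) (negbTE (no _ _ _)) /alternate; lia.
- lia.
by rewrite crossing_lt // /alternate; lia.
Qed.

Lemma eq_off c p q : (p == q) = (off c p == off c q).
Proof. by rewrite (inj_eq (@off_inj c)). Qed.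

Lemma crossing_off c p q r s :
  crossing [set p; q]%SET [set r; s]%SET
    = alternate (off c p) (off c q) (off c r) (off c s).
Proof.
(* Moving the origin to [c] flips a comparison when [c] separates the points. *)
have lt_off x y : x != y ->
    (off c x < off c y) = (x < y) (+) (c <= x) (+) (c <= y).
  move=> nxy; rewrite /off; case: (leqP c x) => hx; case: (leqP c y) => hy;
    rewrite ?addbT ?addbF ?negbK; apply/idP/idP; circ.
rewrite crossing_val /alternate -!ord_eqE !(eq_off c).
case: (eqVneq (off c p)) => //= e1; case: (eqVneq (off c p)) => //= e2.
case: (eqVneq (off c q)) => //= e3; case: (eqVneq (off c q)) => //= e4.
have h x y : off c x != off c y -> x != y by apply: contra_neq => ->.
rewrite !lt_off ?h //.
by case: (p < r); case: (p < s); case: (q < r); case: (q < s);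
  case: (c <= p); case: (c <= q); case: (c <= r); case: (c <= s).
Qed.

Lemma eqP_off c p q : (p = q) = (off c p = off c q).
Proof. by apply: propext; split=> [->//|]; apply: off_inj. Qed.

Lemma ordS_eq_off c p q : (q == ordS p) =
  (off c q == (off c p).+1) || (off c q == 0) && (off c p == n.-1).
Proof. by apply/idP/idP; circ. Qed.

Lemma K'_edge_off c p q : K'_edge p q =
  (off c p + 1 < off c q) && (off c q < off c p + n.-1) ||
  (off c q + 1 < off c p) && (off c p < off c q + n.-1).
Proof.
rewrite /K'_edge /cyclically_adjacent !(ordS_eq_off c) (eq_off c).
move: (off_lt c p) (off_lt c q) => ? ?.
by apply/idP/idP; lia.
Qed.

Lemma cyclically_adjacent_off c p q : cyclically_adjacent p q =
  [|| off c q == (off c p).+1, off c p == (off c q).+1,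
      (off c p == 0) && (off c q == n.-1) | (off c q == 0) && (off c p == n.-1)].
Proof.
rewrite /cyclically_adjacent !(ordS_eq_off c).
move: (off_lt c p) (off_lt c q) => ? ?.
by apply/idP/idP; lia.
Qed.

Lemma off0 c : off c c = 0. Proof. circ. Qed.

Lemma off_off_spec c a p :
  off c a <= off c p /\ off a p = off c p - off c a
  \/ off c p < off c a /\ off a p = off c p + n - off c a.
Proof.
move: (ltn_ord c) (ltn_ord a) (ltn_ord p) => ? ? ?.
by rewrite /off; case: (leqP c a) => ?; case: (leqP c p) => ?;
  case: (leqP a p) => ?; lia.
Qed.

Lemma off_turn_spec c a m : m <= n ->
  off c a + m < n /\ off c (turn a m) = off c a + m
  \/ off c (turn a m) + n = off c a + m.
Proof. circ. Qed.

Lemma off_ordS_spec c a :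
  (off c a).+1 < n /\ off c (ordS a) = (off c a).+1
  \/ (off c a).+1 = n /\ off c (ordS a) = 0.
Proof. circ. Qed.

End Circle.

(** Linear arithmetic on the offsets from the base point [c]. Cutting the circle
    at a point of the configuration leaves far fewer cases than [circ]. *)
Ltac based c := intros; pose proof (off0 c);
  repeat match goal with
  | H : _ |- _ => rewrite !(eqP_off c) in H
  | H : _ |- _ => rewrite !(crossing_off c) in H
  | H : _ |- _ => rewrite !(K'_edge_off c) in H
  | H : _ |- _ => rewrite !(cyclically_adjacent_off c) in H
  | H : _ |- _ => rewrite !(eq_off c) in H
  end;
  rewrite ?(crossing_off c) ?(K'_edge_off c) ?(cyclically_adjacent_off c)
    ?(eq_off c) ?(eqP_off c);
  repeat match goal with H : _ |- _ => rewrite !alternateE in H end;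
  rewrite ?alternateE;
  repeat match goal with
  | |- context[off c (turn ?a ?b)] => add_fact (off_turn_spec c a (m := b))
  | H : context[off c (turn ?a ?b)] |- _ => add_fact (off_turn_spec c a (m := b))
  | |- context[off c (ordS ?a)] => add_fact (off_ordS_spec c a)
  | H : context[off c (ordS ?a)] |- _ => add_fact (off_ordS_spec c a)
  | |- context[off c ?a] => add_fact (off_lt c a)
  | H : context[off c ?a] |- _ => add_fact (off_lt c a)
  end; lia.

(** * Faces of a triangulation *)

Section Triangulations.
Variable n : nat.
Implicit Types (p q r s a b w : 'I_n) (e f t : {set 'I_n}) (T : {set {set 'I_n}}).

Lemma external_edge2 p q : external_edge [set p; q]%SET = cyclically_adjacent p q.
Proof.
apply/existsP/orP.
  by case=> i /eqP/set2_eq[] [-> ->]; rewrite ?eqxx; [left|right].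
case=> /eqP->; first by exists p.
by exists q; rewrite finset.setUC.
Qed.

Lemma chord2 p q : chord [set p; q]%SET = K'_edge p q.
Proof. by rewrite /chord external_edge2 cards2 /K'_edge; case: (p == q). Qed.

Lemma chordP e : chord e -> exists p q, K'_edge p q /\ e = [set p; q]%SET.
Proof.
move=> ce; have /andP[/cards2P[p [q [npq e_pq]]] _] := ce.
by exists p, q; split=> //; rewrite -chord2 -e_pq.
Qed.

Lemma crossing_id e : ~~ crossing e e.
Proof.
apply/negP; case/existsP=> a /existsP[b /existsP[c /existsP[d /and4P[ab bc cd]]]].
by case/orP=> /andP[/eqP-> /eqP/set2_eq[[]|[]]]; circ.
Qed.

Definition edge T p q := external_edge [set p; q]%SET || ([set p; q]%SET \in T).

Lemma edgeC T p q : edge T p q = edge T q p.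
Proof. by rewrite /edge (finset.setUC [set p]%SET). Qed.

Lemma triangle3 T p q r : p != q -> q != r -> p != r ->
  triangle T [set p; q; r]%SET = [&& edge T p q, edge T q r & edge T p r].
Proof.
move=> npq nqr npr; rewrite /triangle.
have -> /= : #|[set p; q; r]%SET| == 3.
  by rewrite finset.setUC cardsU1 cards2 npq !inE negb_or ![r == _]eq_sym npr nqr.
apply/forall_inP/and3P => [h|[epq eqr epr] i].
  have E i j : i \in [set p; q; r]%SET -> j \in [set p; q; r]%SET -> i != j -> edge T i j.
    by move=> hi hj; move/forall_inP: (h i hi) => /(_ j hj) /implyP.
  by split; apply: E; rewrite ?inE ?eqxx ?orbT.
rewrite !inE => hi; apply/forall_inP => j; rewrite !inE => hj.
apply/implyP; rewrite -/(edge T i j).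
by case/orP: hi => [/orP[]|] /eqP->; case/orP: hj => [/orP[]|] /eqP->;
  rewrite ?eqxx // 1?edgeC.
Qed.

(** Among the neighbours of [p] strictly between [p] and [q], let [w] be the last.
    If [w] and [q] were not joined, then by maximality some chord would cross
    [w, q]; not crossing [p, q] or [p, w], it would end in [p] and in a later
    neighbour of [p]. *)
Lemma face_beyond T p q : triangulation T -> [set p; q]%SET \in T ->
  exists w, [/\ 0 < off p w < off p q, edge T p w & edge T w q].
Proof.
move=> /maxsetP[/andP[/forall_inP Tc /forall_inP Tx] Tmax] Tpq.
have := Tc _ Tpq; rewrite chord2 => pq.
have Tnx u v x y : [set u; v]%SET \in T -> [set x; y]%SET \in T ->
    ~~ crossing [set u; v]%SET [set x; y]%SET.
  by move=> uv xy; move/forall_inP: (Tx _ uv) => /(_ _ xy).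
have h0 : (0 < off p (ordS p) < off p q) && edge T p (ordS p).
  rewrite /edge external_edge2 /cyclically_adjacent eqxx andbT.
  by based p.
pose P w := (0 < off p w < off p q) && edge T p w.
case: (@arg_maxnP _ (ordS p) P (off p) h0) => w /andP[w_pq epw] wmax.
exists w; split=> //; rewrite /edge.
case: (boolP (external_edge _)) => //= wq; rewrite external_edge2 in wq.
suff nc : noncrossing_chords ([set w; q]%SET |: T)%SET.
  by rewrite -(Tmax _ nc) ?setU11 ?finset.subsetUr.
have nwq : w != q by apply/eqP => ewq; rewrite ewq ltnn andbF in w_pq.
have wqT f : f \in T -> ~~ crossing [set w; q]%SET f.
  move=> Tf; have [s [t [st ef]]] := chordP (Tc _ Tf); rewrite {f}ef in Tf *.
  have npq_st := Tnx _ _ _ _ Tpq Tf.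
  have npw_st : ~~ crossing [set p; w]%SET [set s; t]%SET.
    case/orP: epw => [|/Tnx h]; last exact: h Tf.
    by rewrite external_edge2 => pw; clear -w_pq pw; based p.
  (* The crossing chord ends in [p], so its other end is a neighbour of [p]
     beyond [w]. *)
  apply/negP => x.
  have [es|et] : s = p \/ t = p.
  - case: (eqVneq s p) => [->|ns]; [by left|right].
    by clear -w_pq npq_st npw_st x ns; based p.
  - have : P t.
      rewrite /P /edge -es Tf orbT andbT es.
      by clear -x w_pq es; based p.
    by move/wmax; clear -x w_pq es; based p.
  - have : P s.
      rewrite /P edgeC /edge -et Tf orbT andbT et.
      by clear -x w_pq et; based p.
    by move/wmax; clear -x w_pq et; based p.
apply/andP; split; apply/forall_inP => e; rewrite in_setU1 => /orP[/eqP->|Te].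
- by rewrite chord2 /K'_edge nwq.
- exact: Tc.
- by apply/forall_inP => f; rewrite in_setU1 => /orP[/eqP->|/wqT//]; apply: crossing_id.
- apply/forall_inP => f; rewrite in_setU1 => /orP[/eqP->|Tf].
    by rewrite crossing_sym wqT.
  by move/forall_inP: (Tx _ Te) => /(_ _ Tf).
Qed.

End Triangulations.

(** * Staircases and their nested diagonals *)

Section Staircases.
Variable n : nat.
Hypothesis n_gt4 : 4 < n.

Lemma label_gt0 : 0 < n - 3. Proof. lia. Qed.

Definition label (k : nat) : 'I_(n - 3) := insubd (Ordinal label_gt0) k.

Lemma labelK k : k < n - 3 -> label k = k :> nat.
Proof. by move=> lt_k; rewrite /label insubdK. Qed.

Lemma label_val (i : 'I_(n - 3)) : label i = i.
Proof. by apply: ord_inj; rewrite labelK. Qed.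

(** A staircase lists the first elements of the members of an increasing chain
    of cyclic intervals, each one longer than the previous one by a single
    element, which is added at the end ([l j = l i]) or at the front. *)
Definition staircase (l : {ffun 'I_(n - 3) -> 'I_n}) : bool :=
  [forall i : 'I_(n - 3), forall j : 'I_(n - 3),
     (j == i.+1 :> nat) ==> (l j == l i) || (l i == ordS (l j))].

Implicit Types (l m : {ffun 'I_(n - 3) -> 'I_n}) (i j k : 'I_(n - 3)).

Lemma staircase_step l i j : staircase l -> j = i.+1 :> nat ->
  l j = l i \/ l i = ordS (l j).
Proof.
move=> /forallP/(_ i)/forallP/(_ j)/implyP h e.
by have /orP[/eqP|/eqP] := h (introT eqP e); [left|right].
Qed.

Lemma staircase_le l i j : staircase l -> i <= j -> off (l j) (l i) <= j - i.
Proof.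
move=> sl; move: {2}(j - i) (erefl (j - i)) => d; elim: d j => [|d IH] j ed le_ij.
  by rewrite (_ : i = j) ?off0 //; apply: ord_inj; lia.
have lt_j := ltn_ord j; have hk : (label j.-1 : nat) = j.-1 by rewrite labelK; lia.
have := IH (label j.-1); have := @staircase_step l (label j.-1) j sl.
rewrite !hk => hs hi.
have {}hi : off (l (label j.-1)) (l i) <= j.-1 - i by apply: hi; lia.
have {}hs : l j = l (label j.-1) \/ l (label j.-1) = ordS (l j) by apply: hs; lia.
case: hs => hs; first by rewrite hs; lia.
have := ltn_ord i; move: hi hs; circ.
Qed.

Definition differ_once l m : Prop :=
  exists i, l i != m i /\ forall j, j != i -> l j = m j.

Lemma differ_once_sym l m : differ_once l m -> differ_once m l.
Proof. by case=> i [ni e]; exists i; rewrite eq_sym; split=> // j /e. Qed.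

(** The neighbours of the step [i], which both staircases share, leave exactly
    two values for this step. *)
Lemma differ_once_step l m i : staircase l -> staircase m ->
  l i != m i -> (forall j, j != i -> l j = m j) ->
  let lower l m := [/\ l i = ordS (m i),
    forall j, i = j.+1 :> nat -> l j = l i & forall j, j = i.+1 :> nat -> l j = m i]
  in lower l m \/ lower m l.
Proof.
move=> sl sm ni e /=; have lt_i := ltn_ord i.
have before j : i = j.+1 :> nat -> l j = m j by move=> ej; apply: e; rewrite ord_eqE; lia.
have after j : j = i.+1 :> nat -> l j = m j by move=> ej; apply: e; rewrite ord_eqE; lia.
have [h|h] : l i = ordS (m i) \/ m i = ordS (l i).
- have [i0|ipos] := posnP i.
    have ej : (label i.+1 : nat) = i.+1 by rewrite labelK; lia.
    have := staircase_step sl ej; have := staircase_step sm ej.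
    by move: ni; rewrite (after _ ej); circ.
  have ej : i = (label i.-1).+1 :> nat by rewrite labelK; lia.
  have := staircase_step sl ej; have := staircase_step sm ej.
  by move: ni; rewrite (before _ ej); circ.
- left; split=> // j ej.
    have := staircase_step sl ej; have := staircase_step sm ej.
    by rewrite (before _ ej) h; circ.
  have := staircase_step sl ej; have := staircase_step sm ej.
  by rewrite (after _ ej) h; circ.
- right; split=> // j ej.
    have := staircase_step sl ej; have := staircase_step sm ej.
    by rewrite (before _ ej) h; circ.
  have := staircase_step sl ej; have := staircase_step sm ej.
  by rewrite (after _ ej) h; circ.
Qed.

(** The chord that cuts off the [k.+1] vertices following [a]. *)
Definition diag (a : 'I_n) (k : nat) : {set 'I_n} := [set a; turn a k.+2]%SET.

Definition stair_coloring l : coloring n := [ffun k => diag (l k) k].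

Lemma stair_coloringE l k : stair_coloring l k = diag (l k) k.
Proof. by rewrite ffunE. Qed.

Lemma diag_nested_neq l i j : staircase l -> i < j -> diag (l i) i <> diag (l j) j.
Proof.
move=> sl lt_ij; have lt_j := ltn_ord j.
have := staircase_le sl (ltnW lt_ij) => le e.
case: (set2_eq e); clear -le lt_ij lt_j n_gt4; based (l j).
Qed.

Lemma stair_coloring_inj l : staircase l -> injective (stair_coloring l).
Proof.
move=> sl i j; rewrite !stair_coloringE => e; apply: ord_inj.
by case: (ltngtP i j) => // h; case: (diag_nested_neq sl h).
Qed.

Lemma diag_noncrossing l i j : staircase l -> ~~ crossing (diag (l i) i) (diag (l j) j).
Proof.
wlog le_ij : i j / i <= j.
  by move=> W sl; case: (leqP i j) => [/W|/ltnW/W]; last rewrite crossing_sym; exact.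
move=> sl; have lt_j := ltn_ord j; have := staircase_le sl le_ij => le.
rewrite /diag; clear -le le_ij lt_j n_gt4; based (l j).
Qed.

Lemma diag_edge (a : 'I_n) (k : nat) : k < n - 3 -> K'_edge a (turn a k.+2).
Proof. by move=> lt_k; based a. Qed.

Lemma chords_ofP (c : coloring n) e : reflect (exists k, e = c k) (e \in chords_of c).
Proof. by apply: (iffP imsetP) => [[k _ ->]|[k ->]]; exists k. Qed.

(** Walking outwards through the nested arcs, a chord that crosses no diagonal
    keeps both endpoints outside the open arcs: the first arc to swallow an
    endpoint would force the chord to be the previous diagonal. Both endpoints
    finally lie among the last three vertices. *)
Lemma stair_saturated l (p q : 'I_n) : staircase l -> K'_edge p q ->
  (forall k, ~~ crossing [set p; q]%SET (diag (l k) k)) ->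
  exists k, [set p; q]%SET = diag (l k) k.
Proof.
move=> sl pq nx.
have diagE k u v : u = l k /\ v = turn (l k) k.+2 \/ v = l k /\ u = turn (l k) k.+2 ->
    [set u; v]%SET = diag (l k) k.
  by case=> -[-> ->] //; rewrite finset.setUC.
pose out (k : nat) (v : 'I_n) :=
    (off (l (label k)) v == 0) || (k.+1 < off (l (label k)) v).
have [[k e]|] := pselect (exists k, [set p; q]%SET = diag (l k) k); first by exists k.
move=> no; exfalso.
have no' k : ~ (p = l k /\ q = turn (l k) k.+2 \/ q = l k /\ p = turn (l k) k.+2).
  by move=> h; apply: no; exists k; apply: diagE.
have outP (k : nat) : k < n - 3 -> out k p && out k q.
  elim: k => [|k IH] lt_k; rewrite /out.
    have := nx (label 0); have := no' (label 0); rewrite labelK // /diag.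
    set a := l _ => {}no' {}nx; clear -pq nx no' n_gt4; based a.
  have /andP[] := IH (ltnW lt_k); rewrite /out.
  have ek : (label k.+1 : nat) = (label k).+1 by rewrite !labelK //; lia.
  have := staircase_step sl ek.
  set a := l (label k); set b := l (label k.+1) => sab op oq.
  suff step u v : K'_edge u v ->
      ~~ crossing [set u; v]%SET (diag b k.+1) ->
      ~ (u = a /\ v = turn a k.+2 \/ v = a /\ u = turn a k.+2) ->
      (off a u == 0) || (k.+1 < off a u) -> (off a v == 0) || (k.+1 < off a v) ->
      (off b u == 0) || (k.+2 < off b u).
    have nxb : ~~ crossing [set p; q]%SET (diag b k.+1).
      by have := nx (label k.+1); rewrite labelK.
    have nob : ~ (p = a /\ q = turn a k.+2 \/ q = a /\ p = turn a k.+2).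
      by have := no' (label k); rewrite labelK // ltnW.
    rewrite (step p q pq nxb nob op oq); apply: (step q p) oq op.
    - by move: pq; clear; based p.
    - by rewrite finset.setUC.
    - by move: nob; tauto.
  clear -sab lt_k n_gt4 => uv nx no ou ov; apply: contraT => iu; exfalso.
  case: sab => sab.
    rewrite -sab in ou ov no.
    have eu : u = turn b k.+2 by clear -ou iu lt_k; based b.
    by subst u; clear -uv nx no ov lt_k; rewrite /diag in nx; based b.
  have eu : u = a.
    have := off_off_spec b a u; clear -ou iu lt_k sab; based b.
  have {ov}ov : (off b v == 0) || (off b v == 1) || (k.+2 < off b v).
    have := off_off_spec b a v; clear -ov lt_k sab; based b.
  apply: no; left; split=> //; subst u; rewrite sab in uv nx *.
  have {ov}ov : off b v = k.+3.
    by clear -uv nx ov lt_k; rewrite /diag in nx; based b.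
  by clear -ov lt_k; based b.
have lt_k : n - 4 < n - 3 by lia.
have := outP _ lt_k; rewrite /out; have := no' (label (n - 4)); rewrite labelK //.
set a := l _; clear -pq n_gt4; based a.
Qed.
End Staircases.

(** * Staircases and colored triangulations *)

Section ColoredTriangulations.
Variable n : nat.
Hypothesis n_gt4 : 4 < n.

Implicit Types (l m : {ffun 'I_(n - 3) -> 'I_n}) (i j k : 'I_(n - 3)).
Implicit Types (c : coloring n) (t e : {set 'I_n}) (a b x y u v w : 'I_n).
Notation label := (label n_gt4).

Lemma stair_triangulation l : staircase l ->
  triangulation (chords_of (stair_coloring l)).
Proof.
move=> sl; apply/maxsetP; split=> [|B /andP[/forall_inP Bc /forall_inP Bx] sub].
  apply/andP; split; apply/forall_inP => e /chords_ofP[k ->].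
    by rewrite stair_coloringE chord2 diag_edge.
  apply/forall_inP => f /chords_ofP[j ->].
  by rewrite !stair_coloringE diag_noncrossing.
apply/eqP; rewrite finset.eqEsubset sub andbT; apply/fintype.subsetP => e Be.
have [p [q [pq ee]]] := chordP (Bc _ Be); rewrite {e}ee in Be *.
apply/chords_ofP; have [k|k ->] := stair_saturated n_gt4 sl pq; last first.
  by exists k; rewrite stair_coloringE.
move/forall_inP: (Bx _ Be) => /(_ (diag (l k) k)); apply.
by apply: (fintype.subsetP sub); apply/chords_ofP; exists k; rewrite stair_coloringE.
Qed.

Lemma triangle_chord (T : {set {set 'I_n}}) t x y : triangle T t ->
  x \in t -> y \in t -> K'_edge x y -> [set x; y]%SET \in T.
Proof.
move=> /andP[_ /forall_inP h] /h/forall_inP{}h /h/implyP{}h /andP[nxy nadj].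
by have := h nxy; rewrite external_edge2 (negbTE nadj).
Qed.

Lemma triangulation_noncrossing (T : {set {set 'I_n}}) e f :
  triangulation T -> e \in T -> f \in T -> ~~ crossing e f.
Proof.
by move=> /maxsetP[/andP[_ /forall_inP h] _] /h/forall_inP{}h /h.
Qed.

(** Two nested diagonals in a triangle share an endpoint, since otherwise the
    joins of their endpoints would be crossing chords. If their labels are not
    consecutive, the third side is a chord, and it crosses the diagonal labeled
    [i.+1]. *)
Lemma stair_triangle_labels l t i j : staircase l ->
  triangle (chords_of (stair_coloring l)) t ->
  stair_coloring l i \subset t -> stair_coloring l j \subset t -> i < j ->
  j = i.+1 :> nat.
Proof.
move=> sl; set T := chords_of _ => tt it jt lt_ij.
have lt_j := ltn_ord j.
case: (ltngtP j i.+1) => // [|lt_i1j]; first lia.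
have Tx := triangulation_noncrossing (stair_triangulation sl).
have T_diag k : diag (l k) k \in T.
  by apply/chords_ofP; exists k; rewrite stair_coloringE.
have ek : label i.+1 = i.+1 :> nat by rewrite labelK //; lia.
have sk := staircase_step sl ek.
have le_kj : label i.+1 <= j by rewrite ek; lia.
have := staircase_le n_gt4 sl le_kj; have := staircase_le n_gt4 sl (ltnW lt_ij).
have := T_diag (label i.+1); rewrite ek; set ak := l (label _) in sk *.
rewrite !stair_coloringE in it jt *; set ai := l i in it sk *; set aj := l j in jt *.
move=> Tk le1 le2.
have it1 : ai \in t by apply: (fintype.subsetP it); rewrite !inE eqxx.
have it2 : turn ai i.+2 \in t by apply: (fintype.subsetP it); rewrite !inE eqxx orbT.
have jt1 : aj \in t by apply: (fintype.subsetP jt); rewrite !inE eqxx.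
have jt2 : turn aj j.+2 \in t by apply: (fintype.subsetP jt); rewrite !inE eqxx orbT.
have E x y := @triangle_chord T t x y tt.
exfalso.
have [e|ne] := eqVneq ai aj.
  have K : K'_edge (turn ai i.+2) (turn aj j.+2).
    by clear -lt_i1j lt_j e; based aj.
  have eak : ak = aj by clear -lt_i1j lt_j e sk le2; based aj.
  have := Tx _ _ (E _ _ it2 jt2 K) Tk.
  by rewrite eak e /diag; clear -lt_i1j lt_j; based aj.
have [e|ne'] := eqVneq (turn ai i.+2) (turn aj j.+2).
  have K : K'_edge aj ai.
    by clear -lt_i1j lt_j e le1; based aj.
  have eai : off aj ai = j - i by clear -lt_i1j lt_j e le1; based aj.
  have eak : off aj ak = j - i.+1.
    by clear -lt_i1j lt_j eai sk le2; based aj.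
  have := Tx _ _ (E _ _ jt1 it1 K) Tk.
  by rewrite /diag; clear -lt_i1j lt_j eai eak; based aj.
have K1 : K'_edge aj (turn ai i.+2).
  by clear -lt_i1j lt_j ne' le1; based aj.
have K2 : K'_edge ai (turn aj j.+2).
  by clear -lt_i1j lt_j ne' ne le1; based aj.
have := Tx _ _ (E _ _ jt1 it2 K1) (E _ _ it1 jt2 K2).
clear -lt_i1j lt_j ne' ne le1; based aj.
Qed.

Lemma stair_triangle_consecutive l t i j : staircase l ->
  triangle (chords_of (stair_coloring l)) t ->
  stair_coloring l i \subset t -> stair_coloring l j \subset t -> i != j ->
  (j == i.+1 :> nat) || (i == j.+1 :> nat).
Proof.
move=> sl tt it jt nij; case: (ltngtP i j) => h; last by case/eqP: nij; apply: ord_inj.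
  by rewrite (stair_triangle_labels sl tt it jt h) eqxx.
by rewrite (stair_triangle_labels sl tt jt it h) eqxx orbT.
Qed.

Lemma stair_CTFT l : staircase l -> stair_coloring l \in CTFT n.
Proof.
move=> sl; rewrite inE; apply/and3P; split.
- exact: stair_triangulation.
- apply/existsP => -[t /andP[tt /eqP c3]].
  have /card_gt2P[e1 [e2 [e3 [[m1 m2 m3] [n12 n23 n31]]]]] :
      2 < #|internal_edges (chords_of (stair_coloring l)) t|.
    by rewrite c3.
  move: m1 m2 m3 n12 n23 n31; rewrite !inE.
  move=> /andP[/chords_ofP[i1 ->] s1] /andP[/chords_ofP[i2 ->] s2] /andP[/chords_ofP[i3 ->] s3].
  rewrite !(inj_eq (stair_coloring_inj n_gt4 sl)) => n12 n23 n31.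
  have := stair_triangle_consecutive sl tt s1 s2 n12.
  have := stair_triangle_consecutive sl tt s2 s3 n23.
  have := stair_triangle_consecutive sl tt s3 s1 n31; lia.
- apply/and3P; split.
  + exact/injectiveP/stair_coloring_inj.
  + apply/existsP; exists (label 0); rewrite labelK /=; last lia.
    rewrite stair_coloringE /short_chord chord2 diag_edge //.
    apply/existsP; exists (ordS (l (label 0))).
    by rewrite ordSK /diag labelK //; lia.
  + apply/forallP => t; apply/implyP => tt; apply/implyP => _.
    apply/forallP => i; apply/forallP => j; apply/implyP => /and3P[nij it jt].
    exact: stair_triangle_consecutive tt it jt nij.
Qed.

Lemma internal_edges_le3 (T : {set {set 'I_n}}) t : triangulation T ->
  triangle T t -> #|internal_edges T t| <= 3.
Proof.
move=> /maxsetP[/andP[/forall_inP Tc _] _] /andP[/eqP t3 _].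
have -> : 3 = #|[set e : {set 'I_n} | (e \subset t) && (#|e| == 2)]%SET|.
  by rewrite cards_draws t3.
apply: subset_leq_card; apply/fintype.subsetP => e; rewrite !inE => /andP[Te ->].
by have /andP[] := Tc _ Te.
Qed.

(** The triangle on the side of [c k] from [b] to [a] has a second internal edge,
    because this side has at least two more vertices, and no third one, because
    the triangulation is triangle-free. So the labels of its two internal edges
    are consecutive, and its apex [w] is next to an endpoint of [c k]. *)
Lemma next_label c k a b : c \in CTFT n -> c k = [set a; b]%SET ->
  2 < off b a ->
  exists w, 0 < off b w < off b a /\
    exists x y, [/\ [set x; y]%SET = [set a; b]%SET, cyclically_adjacent y w
     & exists j, [/\ c j = [set x; w]%SET, j != k & (j == k.+1 :> nat) || (k == j.+1 :> nat)]].
Proof.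
rewrite inE => /and3P[tc tf /and3P[/injectiveP cinj _ /forallP prop]] ck gap.
set T := chords_of c in tc tf prop.
have Tck : c k \in T by apply/chords_ofP; exists k.
have Tba : [set b; a]%SET \in T by rewrite finset.setUC -ck.
have [w [wI ebw ewa]] := face_beyond tc Tba.
exists w; split=> //.
have nba : b != a by clear -gap; based b.
have nbw : b != w by clear -wI; based b.
have nwa : w != a by clear -wI; based b.
have nsub x y z : x != z -> y != z -> [set x; y]%SET != [set y; z]%SET :> {set 'I_n}.
  move=> nxz nyz; apply/eqP => e; have := set22 y z; rewrite -e !inE.
  by rewrite ![z == _]eq_sym (negbTE nxz) (negbTE nyz).
have tt : triangle T [set b; w; a]%SET by rewrite triangle3 // ebw ewa /edge Tba orbT.
set t := [set b; w; a]%SET in tt.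
have bt : b \in t by rewrite !inE eqxx.
have wt : w \in t by rewrite !inE eqxx orbT.
have at_ : a \in t by rewrite !inE eqxx orbT.
have sub2 x y : x \in t -> y \in t -> [set x; y]%SET \subset t.
  by move=> xt yt; rewrite finset.subUset !finset.sub1set xt yt.
have le2 : #|internal_edges T t| <= 2.
  have := internal_edges_le3 tc tt; rewrite leq_eqVlt => /orP[e3|//].
  by case/negP: tf; apply/existsP; exists t; rewrite tt.
(* The endpoint [x] of [c k] joined to [w] by a chord is the one that the next
   diagonal keeps. *)
have finish x y : x \in t -> y \in t -> [set x; y]%SET = [set a; b]%SET -> x != w -> y != w ->
   [set x; w]%SET \in T ->
   exists j, [/\ c j = [set x; w]%SET, j != k & (j == k.+1 :> nat) || (k == j.+1 :> nat)].
  move=> xt yt exy nxw nyw Txw; have /chords_ofP[j ej] := Txw; exists j.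
  have njk : j != k.
    apply/eqP => ejk; have := set22 x w.
    by rewrite ej ejk ck !inE (negbTE nwa) eq_sym (negbTE nbw).
  have nck : c k != c j by rewrite (inj_eq cinj) eq_sym.
  split=> //.
  have i2 : #|internal_edges T t| == 2.
    rewrite eqn_leq le2; apply/card_gt1P; exists (c k), (c j).
    by rewrite !inE Tck -ej Txw ck !sub2 // -ck ej.
  have /implyP/(_ tt)/implyP/(_ i2)/forallP/(_ k)/forallP/(_ j)/implyP := prop t.
  by apply; rewrite eq_sym njk -ej ck !sub2.
have extE x y : external_edge [set x; y]%SET -> cyclically_adjacent x y.
  by rewrite external_edge2.
case/orP: (ebw) => [/extE ext|Tbw].
  case/orP: (ewa) => [/extE ext'|Twa].
    by exfalso; clear -ext ext' gap wI; based b.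
  exists a, b; split=> //; apply: (finish a b) => //; rewrite 1?eq_sym //.
  by rewrite finset.setUC.
case/orP: (ewa) => [/extE ext'|Twa].
  exists b, a; split=> //; first by rewrite finset.setUC.
    by move: ext'; rewrite /cyclically_adjacent orbC.
  apply: (finish b a) => //; rewrite 1?eq_sym //.
  by rewrite finset.setUC.
exfalso; move: le2; rewrite leqNgt => /negP; apply; apply/card_gt2P.
exists [set b; w]%SET, [set w; a]%SET, [set a; b]%SET; split; split.
- by rewrite !inE Tbw sub2.
- by rewrite !inE Twa sub2.
- by rewrite !inE finset.setUC Tba sub2.
- by rewrite nsub.
- by rewrite nsub // eq_sym.
- by rewrite nsub // eq_sym.
Qed.

(** The diagonals are recovered outwards from the short chord labeled [0]:
    [next_label] provides a chord with the label preceding or following that of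
    the last diagonal, and the preceding one is already known to lie on the
    inner side. *)
Lemma CTFT_stair c : c \in CTFT n -> exists2 l, staircase l & c = stair_coloring l.
Proof.
move=> cT.
have main (K : nat) : K < n - 3 -> exists l : nat -> 'I_n,
    (forall j : nat, j <= K -> c (label j) = diag (l j) j) /\
    (forall j : nat, j < K -> l j.+1 = l j \/ l j = ordS (l j.+1)).
  elim: K => [|K IH] lt_K.
    have := cT; rewrite inE => /and3P[_ _ /and3P[_ k_short _]].
    have {k_short}/existsP[k /andP[/eqP k0 /andP[_ /existsP[x /eqP ck]]]] := k_short.
    exists (fun=> ord_pred x); split=> // j.
    rewrite leqn0 => /eqP->; rewrite (_ : label 0 = k) ?ck; last first.
      by apply: ord_inj; rewrite labelK ?k0.
    by rewrite /diag /turn /= ord_predK.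
  have [l [cl sl]] := IH (ltnW lt_K).
  have ck := cl K (leqnn K); set a := l K in ck; set b := turn a K.+2.
  have gap : 2 < off b a.
    by rewrite /b; clear -lt_K; have := off_off_spec a (turn a K.+2) a; based a.
  have kK : label K = K :> nat by rewrite labelK // ltnW.
  have [w [wI [x [y [exy yw [j [cj njk ij]]]]]]] := next_label cT ck gap.
  have wO : K.+2 < off a w.
    by rewrite /b in wI; clear -wI lt_K; have := off_off_spec a (turn a K.+2) w;
     have := off_off_spec a (turn a K.+2) a; based a.
  (* The diagonal labeled [K.-1], inside the arc of [c K], does not reach [w]. *)
  have ejK : j = K.+1 :> nat.
    rewrite kK in ij; case/orP: ij => /eqP // eK; exfalso.
    have ej : label j = j by rewrite label_val.
    have := cl j; rewrite ej cj => /(_ (leq_trans (leqnSn _) (eq_leq (esym eK)))) e.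
    have : w \in [set x; w]%SET by rewrite !inE eqxx orbT.
    rewrite e !inE; have := sl j; rewrite -eK => /(_ (leqnn _)); rewrite -/a.
    by clear -wO lt_K eK; based a.
  have eL : label K.+1 = j by apply: ord_inj; rewrite labelK.
  suff [z [cz sz]] : exists z, c j = diag z K.+1 /\ (z = a \/ a = ordS z).
    exists (fun i : nat => if i <= K then l i else z); split=> i.
      rewrite leq_eqVlt ltnS => /orP[/eqP->|le_i]; last by rewrite le_i cl.
      by rewrite ltnn eL.
    rewrite ltnS => le_i; rewrite le_i; case: ltngtP le_i => // [lt_i _|-> _]; last exact: sz.
    exact: sl.
  case/set2_eq: exy => -[? ?]; subst x y.
    exists a; split; [rewrite cj /diag|by left]; congr [set _; _]%SET.
    by rewrite /b in yw wI; clear -yw wI wO lt_K; based a.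
  exists w; split; rewrite ?cj /diag 1?finset.setUC.
    by congr [set _; _]%SET; rewrite /b in wI *; clear -yw wI wO lt_K; based a.
  by right; rewrite /b in wI *; clear -yw wI wO lt_K; based a.
have [l [cl sl]] := main (n - 4) ltac:(lia).
exists [ffun i : 'I_(n - 3) => l i].
  apply/forallP => i; apply/forallP => j; apply/implyP => /eqP e; rewrite !ffunE e.
  have lt_j := ltn_ord j.
  have [] := sl i ltac:(lia); first by move=> ->; rewrite eqxx.
  by move=> <-; rewrite eqxx orbT.
apply/ffunP => i; have lt_i := ltn_ord i.
by rewrite stair_coloringE ffunE -cl ?label_val //; lia.
Qed.

End ColoredTriangulations.

(** * Flips *)

Section Flips.
Variable n : nat.
Hypothesis n_gt4 : 4 < n.

Implicit Types (l m : {ffun 'I_(n - 3) -> 'I_n}) (i j k : 'I_(n - 3)).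
Implicit Types (c : coloring n) (t e : {set 'I_n}) (a b x y u v w : 'I_n).
Notation label := (label n_gt4).

Lemma diag_inj a b (k : nat) : k < n - 3 -> 2 * k.+2 != n ->
  diag a k = diag b k -> a = b.
Proof. by move=> lt_k nk /set2_eq[[]//|[e1 e2]]; clear -lt_k nk e1 e2; based a. Qed.

(** A chord does not know which of its sides is the inner one when it halves
    the polygon; in that case an adjacent diagonal other than the [i]-th one
    decides. *)
Lemma stair_coloring_inj_at l m i k : staircase l -> staircase m ->
  (forall j, j != i -> stair_coloring l j = stair_coloring m j) ->
  k != i -> l k = m k.
Proof.
move=> sl sm e nki; have lt_k := ltn_ord k; have lt_i := ltn_ord i.
have ed j : j != i -> diag (l j) j = diag (m j) j by move/e; rewrite !stair_coloringE.
have [half|nhalf] := eqVneq (2 * k.+2) n; last exact: diag_inj nhalf (ed _ nki).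
case: (set2_eq (ed _ nki)) => [[]//|[e1 e2]]; exfalso.
(* A shared neighbour would bring [l k] and [m k] within distance one, while
   they are [n./2] apart. *)
have near j : (j = k.+1 :> nat) \/ (k = j.+1 :> nat) -> j = i.
  move=> jk; case: (eqVneq j i) => // nji; exfalso.
  have ejj : l j = m j by apply: diag_inj (ltn_ord j) _ (ed _ nji); lia.
  case: jk => jk.
    have := staircase_step sl jk; have := staircase_step sm jk.
    by rewrite ejj; clear -e1 e2 half n_gt4; based (l k).
  have := staircase_step sl jk; have := staircase_step sm jk.
  by rewrite ejj; clear -e1 e2 half n_gt4; based (l k).
have k1 : label k.+1 = k.+1 :> nat by rewrite labelK //; lia.
have k2 : k = (label k.-1).+1 :> nat by rewrite labelK //; lia.
have := near _ (or_introl k1); have := near _ (or_intror k2).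
by move=> <- /(congr1 val) /=; lia.
Qed.

Lemma stair_coloring_inj_stair l m : staircase l -> staircase m ->
  stair_coloring l = stair_coloring m -> l = m.
Proof.
move=> sl sm e; apply/ffunP => k.
have [i nki] : exists i, k != i.
  have [k0|kpos] := posnP k.
    by exists (label 1); rewrite ord_eqE labelK; lia.
  by exists (label 0); rewrite ord_eqE labelK; lia.
by apply: stair_coloring_inj_at sl sm _ nki => j _; rewrite e.
Qed.

(** A flip changes a single diagonal, and does change it, since the new one
    avoids the endpoints of the old one. *)
Lemma flip_differ_once l m i : staircase l -> staircase m ->
  flip i (stair_coloring l) (stair_coloring m) -> differ_once l m.
Proof.
move=> sl sm /existsP[t1 /existsP[t2 /and5P[_ _ _ _]]] /andP[_ /eqP /ffunP ed].
exists i; split=> [|k nki].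
  apply/eqP => eli; have := ed i.
  rewrite !stair_coloringE [X in _ = X]ffunE eqxx -eli => /setP/(_ (l i)).
  by rewrite !inE eqxx.
apply: stair_coloring_inj_at sl sm _ nki => j nji.
by rewrite ed [in RHS]ffunE (negbTE nji).
Qed.

(** With [x = l i] and [y = m i] the vertex before it, the quadrangle around the
    [i]-th diagonal has the vertices [y], [x], [z] and [u], where [x, u] is the
    old diagonal and [y, z] the new one. The sides [x, z] and [y, u] are the
    neighbouring diagonals, or edges of the polygon at the ends of the
    staircase. *)
Lemma lower_flip l m i : staircase l -> staircase m ->
  (forall j, j != i -> l j = m j) -> l i = ordS (m i) ->
  (forall j, i = j.+1 :> nat -> l j = l i) ->
  (forall j, j = i.+1 :> nat -> l j = m i) ->
  flip i (stair_coloring l) (stair_coloring m).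
Proof.
move=> sl sm e step before after; have lt_i := ltn_ord i.
set T := chords_of (stair_coloring l).
have T_diag k : diag (l k) k \in T.
  by apply/chords_ofP; exists k; rewrite stair_coloringE.
set x := l i in step before *; set y := m i in step after *.
pose u := turn x i.+2; pose z := turn y i.+2.
have nxz : x != z by rewrite /z; clear -step lt_i; based y.
have nzu : z != u by rewrite /z /u; clear -step lt_i; based y.
have nxu : x != u by rewrite /u; clear -lt_i; based x.
have nyx : y != x by clear -step n_gt4; based y.
have nyu : y != u by rewrite /u; clear -step lt_i; based y.
have nyz : y != z by rewrite /z; clear -step lt_i; based y.
have adj a b : cyclically_adjacent a b -> edge T a b by rewrite /edge external_edge2 => ->.
have exu : edge T x u by rewrite /edge T_diag orbT.
have exz : edge T x z.
  have [i0|ipos] := posnP i.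
    by apply: adj; rewrite /z; clear -step i0 n_gt4; based y.
  have ei : i = (label i.-1).+1 :> nat by clear -ipos lt_i n_gt4; rewrite labelK; lia.
  rewrite /edge (_ : [set x; z]%SET = diag (l (label i.-1)) (label i.-1)) ?T_diag ?orbT //.
  rewrite (before _ ei) /diag -ei; congr [set _; _]%SET.
  by rewrite /z; clear -step lt_i; based y.
have ezu : edge T z u by apply: adj; rewrite /z /u; clear -step lt_i; based y.
have eyx : edge T y x by apply: adj; rewrite /cyclically_adjacent step eqxx.
have eyu : edge T y u.
  case: (ltnP i.+1 (n - 3)) => hi; last first.
    by apply: adj; rewrite /u; clear -step lt_i hi; based y.
  have ei : label i.+1 = i.+1 :> nat by rewrite labelK.
  rewrite /edge (_ : [set y; u]%SET = diag (l (label i.+1)) (label i.+1)) ?T_diag ?orbT //.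
  rewrite (after _ ei) /diag ei; congr [set _; _]%SET.
  by rewrite /u; clear -step hi; based y.
apply/existsP; exists [set x; z; u]%SET; apply/existsP; exists [set y; x; u]%SET.
have eci : stair_coloring l i = [set x; u]%SET by rewrite stair_coloringE.
apply/and5P; split; last (apply/andP; split).
- apply/eqP => /setP/(_ y); rewrite !inE eqxx (negbTE nyx) (negbTE nyz).
  by rewrite (negbTE nyu).
- by rewrite triangle3 // exz ezu.
- by rewrite triangle3 // eyx exu.
- by rewrite eci finset.subUset !finset.sub1set !inE !eqxx ?orbT.
- by rewrite eci finset.subUset !finset.sub1set !inE !eqxx ?orbT.
apply/eqP/ffunP => k; rewrite [in RHS]ffunE.
case: eqP => [->|/eqP nki]; last by rewrite !stair_coloringE e.
rewrite eci stair_coloringE /diag -/y -/z; apply/setP => v; rewrite !inE.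
case: (eqVneq v y) => [->|]; first by rewrite (negbTE nyx) (negbTE nyu) orbT.
case: (eqVneq v z) => [->|] /=; first by rewrite (eq_sym z x) (negbTE nxz) (negbTE nzu).
by case: (v == x); case: (v == u).
Qed.

Lemma differ_once_flip l m : staircase l -> staircase m -> differ_once l m ->
  exists i, flip i (stair_coloring l) (stair_coloring m)
         || flip i (stair_coloring m) (stair_coloring l).
Proof.
move=> sl sm [i [ni e]]; exists i.
have e' j : j != i -> m j = l j by move/e.
case: (differ_once_step n_gt4 sl sm ni e) => -[st bf af]; apply/orP; [left|right];
  exact: lower_flip.
Qed.

Definition staircase_type := {l : {ffun 'I_(n - 3) -> 'I_n} | staircase l}.

Definition stair_graph (x y : staircase_type) : Prop := differ_once (val x) (val y).

Definition flip_vertex_of (x : staircase_type) : flip_vertex n :=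
  exist (fun c => c \in CTFT n) _ (stair_CTFT n_gt4 (valP x)).

Lemma flip_vertex_of_inj : injective flip_vertex_of.
Proof.
move=> x y /(congr1 val) /= e; apply: val_inj.
exact: stair_coloring_inj_stair (valP x) (valP y) e.
Qed.

Lemma flip_vertex_of_surj (y : flip_vertex n) : exists x : staircase_type, flip_vertex_of x = y.
Proof.
case: y => c cT; have [l sl e] := CTFT_stair n_gt4 cT.
by exists (exist (fun l => staircase l) l sl); apply: val_inj; rewrite /= e.
Qed.

Lemma flip_vertex_of_graph (x y : staircase_type) :
  stair_graph x y <-> flip_graph (flip_vertex_of x) (flip_vertex_of y).
Proof.
split=> [h|[i /orP[]]].
- exact: differ_once_flip (valP x) (valP y) h.
- exact: flip_differ_once (valP x) (valP y).
- by move=> h; apply: differ_once_sym; apply: flip_differ_once (valP y) (valP x) h.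
Qed.

End Flips.

(** * Staircases and classes of arc permutations *)

Section ArcPermutations.
Variable n : nat.
Hypothesis n_gt4 : 4 < n.

Implicit Types (l m : {ffun 'I_(n - 3) -> 'I_n}) (i j : 'I_(n - 3)).
Implicit Types (pi tau : 'S_n) (a b x y u v w p q : 'I_n) (k : nat).
Notation label := (label n_gt4).

Definition place pi b : nat := (pi^-1)%g b.

Lemma place_lt pi b : place pi b < n. Proof. exact: ltn_ord. Qed.

Lemma place_perm pi p : place pi (pi p) = p. Proof. by rewrite /place permK. Qed.

Lemma place_inj pi : injective (place pi).
Proof. by move=> b b' /ord_inj/perm_inj. Qed.

(** The intervals in the definition of arc permutations, without the shift of
    the letters by one, and with their first element as a parameter. *)
Definition starts pi k a : bool := [forall b, (place pi b <= k) == (off a b <= k)].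

Lemma startsP pi k a : reflect (forall b, (place pi b <= k) = (off a b <= k)) (starts pi k a).
Proof. exact: 'forall_eqP. Qed.

Lemma card_initial k : k < n -> #|[set p : 'I_n | p <= k]%SET| = k.+1.
Proof.
move=> lt_k; rewrite cardsE -sum1_card (eq_bigl (fun p : 'I_n => p < k.+1)) //.
by rewrite -(big_ord_widen _ (fun=> 1)) // sum1_card card_ord.
Qed.

Lemma arc_permP pi : reflect (forall k, k < n -> exists a, starts pi k a) (pi \in arc_perms n).
Proof.
rewrite inE; apply: (iffP forallP) => [h k lt_k|h k].
  have /existsP[x /existsP[k' /eqP e]] := h (Ordinal lt_k).
  rewrite -(ord_predK x) in e; move: (ord_pred x) e => {x}a e.
  have ek : k = k'.
    have := card_imset [set p : 'I_n | p <= k]%SET (inj_comp (can_inj (@ordSK n)) (@perm_inj _ pi)).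
    have inj_turn : injective (fun p : 'I_n => turn (ordS a) p).
      by move=> p q /turn_inj h'; apply: ord_inj; apply: h'.
    have := card_imset [set p : 'I_n | p <= k']%SET inj_turn.
    rewrite !card_initial // => c2 c1; apply: succn_inj; rewrite -c1 -c2.
    exact: (congr1 (fun A : {set 'I_n} => #|A|) e).
  exists a; apply/startsP => b.
  have := congr1 (fun A : {set 'I_n} => ordS b \in A) e => /= {}e.
  transitivity (ordS b \in [set ordS (pi m) | m : 'I_n & m <= Ordinal lt_k]%SET).
    apply/idP/imsetP => [le_b|[p]].
      by exists ((pi^-1)%g b); rewrite ?inE // permKV.
    by rewrite inE => le_p /(can_inj (@ordSK n)) ->; rewrite place_perm.
  rewrite e; apply/imsetP/idP => [[p]|].
    rewrite inE -ek -/(turn _ p) => le_p eb.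
    by move: lt_k; clear -eb le_p; based a.
  move=> le_b; have hb := off_lt a b.
  exists (Ordinal hb); first by rewrite inE /= -ek.
  rewrite -/(turn _ _) -[nat_of_ord (Ordinal hb)]/(off a b).
  by clear; based a.
have [a /startsP sa] := h k (ltn_ord k).
apply/existsP; exists (ordS a); apply/existsP; exists k; apply/eqP/setP => b.
apply/imsetP/imsetP => -[p]; rewrite inE => le_p ->.
  have := sa (pi p); rewrite place_perm le_p => /esym le_off.
  exists (Ordinal (off_lt a (pi p))); first by rewrite inE.
  rewrite -/(turn _ _) -[nat_of_ord (Ordinal _)]/(off a (pi p)).
  by clear; based a.
have := sa (turn a p); rewrite off_turn // le_p => le_off.
exists ((pi^-1)%g (turn a p)); first by rewrite inE.
by rewrite permKV -/(turn _ _); have := ltn_ord p; clear; based a.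
Qed.

(** The bound excludes the full circle, which begins anywhere. *)
Lemma starts_uniq pi k a b : k < n.-1 -> starts pi k a -> starts pi k b -> a = b.
Proof.
move=> lt_k /startsP sa /startsP sb.
have := sa b; have := sb b; have := sa (turn a k.+1); have := sb (turn a k.+1).
have := off_off_spec a b (turn a k.+1).
by move=> H ->; rewrite off_turn // 2?ltnNge ?off0; [|lia] => h2 -> h3;
   clear -lt_k H h2 h3; based a.
Qed.

Lemma starts_step pi k a b : k.+1 < n.-1 -> starts pi k a -> starts pi k.+1 b ->
  b = a \/ a = ordS b.
Proof.
move=> lt_k /startsP sa /startsP sb.
have le_k c : off a c <= k -> off b c <= k.+1.
  by rewrite -sa -sb => /leqW.
have ha : off b a <= k.+1 by apply: le_k; rewrite off0.
case: (leqP (off b a) 1) => h; first by clear -h lt_k; based b.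
have := le_k (turn a (k.+2 - off b a)); rewrite off_turn; last by lia.
by move=> /(_ ltac:(lia)); clear -ha h lt_k; based b.
Qed.

(** Singletons and their complements are intervals, as is the full circle. *)
Lemma starts_trivial pi k : k < n -> [|| k == 0, k == n.-2 | k == n.-1] -> exists a, starts pi k a.
Proof.
move=> lt_k; have n_gt0 : 0 < n by lia.
have lt_last : n.-1 < n by lia.
case/or3P => /eqP->.
- exists (pi (Ordinal n_gt0)); apply/startsP => b; set a := pi _.
  have -> : (place pi b <= 0) = (place pi b == place pi a).
    by rewrite place_perm leqn0.
  by rewrite (inj_eq (@place_inj pi)); based a.
- exists (ordS (pi (Ordinal lt_last))); apply/startsP => b; set a := pi _.
  have -> : (place pi b <= n.-2) = (place pi b != place pi a).
    by rewrite place_perm /=; have := place_lt pi b; lia.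
  by rewrite (inj_eq (@place_inj pi)); have := off_off_spec a (ordS a) b; based a.
- exists (pi (Ordinal n_gt0)); apply/startsP => b.
  by have := place_lt pi b; have := off_lt (pi (Ordinal n_gt0)) b; lia.
Qed.

(** Only the intervals of sizes from [2] to [n - 2] are recorded, as these are
    the ones that the switches preserve. *)
Definition follows l pi : bool := [forall j : 'I_(n - 3), starts pi j.+1 (l j)].

Lemma follows_staircase pi l : follows l pi -> staircase l.
Proof.
move=> /forallP f; apply/forallP => i; apply/forallP => j; apply/implyP => /eqP e.
have lt_j := ltn_ord j; have := f j; rewrite e => fj.
have lt_i : i.+2 < n.-1 by lia.
by case: (starts_step lt_i (f i) fj) => ->; rewrite eqxx ?orbT.
Qed.

Lemma follows_exists pi : pi \in arc_perms n -> exists l, follows l pi.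
Proof.
move=> /arc_permP h.
have /fin_all_exists[f fP] : forall j : 'I_(n - 3), exists a, starts pi j.+1 a.
  by move=> j; apply: h; have := ltn_ord j; lia.
by exists [ffun j => f j]; apply/forallP => j; rewrite ffunE.
Qed.

Lemma follows_uniq pi l m : follows l pi -> follows m pi -> l = m.
Proof.
move=> /forallP fl /forallP fm; apply/ffunP => j; have lt_j := ltn_ord j.
by apply: starts_uniq (fl j) (fm j); lia.
Qed.

Lemma place_switch pi p q b k : q = p.+1 :> nat -> k != p ->
  (place (tperm p q * pi)%g b <= k) = (place pi b <= k).
Proof.
move=> eq_q nkp; rewrite /place invMg permM tpermV.
case: tpermP => [->|->|//]; lia.
Qed.

Lemma starts_switch pi p q k a : q = p.+1 :> nat -> k != p ->
  starts (tperm p q * pi)%g k a = starts pi k a.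
Proof.
by move=> eq_q nkp; apply: eq_forallb => b; rewrite place_switch.
Qed.

(** Strictly inside the permutation, the letters that two intervals with common
    neighbours gain are the two ends of an interval of size between [3] and
    [n - 1], and such ends are not cyclically adjacent. *)
Lemma switch_ends pi p q : q = p.+1 :> nat -> cyclically_adjacent (pi p) (pi q) ->
  pi \in arc_perms n -> (tperm p q * pi)%g \in arc_perms n ->
  (p == 0 :> nat) || (p == n.-2 :> nat).
Proof.
move=> eq_q adj /arc_permP hpi /arc_permP htau; set tau := (_ * _)%g in htau.
apply: contraT => ends; exfalso; have lt_q := ltn_ord q.
have [d sd] := hpi p.-1 ltac:(lia).
have sd' : starts tau p.-1 d by rewrite /tau starts_switch //; lia.
have ep : (p : nat) = p.-1.+1 by lia.
have [a sa] := hpi p (ltn_ord p); have [a' sa'] := htau p (ltn_ord p).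
have place_q : place tau (pi q) = p by rewrite /place /tau invMg permM permK tpermV tpermR.
have/startsP sd0 := sd; have /startsP sa0 := sa; have /startsP sa0' := sa'.
have := sd0 (pi p); have := sd0 (pi q); have := sa0 (pi p); have := sa0' (pi q).
rewrite place_q !place_perm eq_q leqnn => h1 h2 h3 h4.
have grow c w : starts pi p c \/ starts tau p c -> off c w <= p -> p.-1 < off d w ->
    off d w = p \/ off d w = n.-1.
  have lt_p : p.-1.+1 < n.-1 by lia.
  rewrite {1 2}ep => sc le_w lt_w; have := off_off_spec d c w.
  have {sc} : c = d \/ d = ordS c.
    by case: sc => sc; [apply: starts_step sd sc|apply: starts_step sd' sc].
  by clear -le_w lt_w lt_p ep; case=> e; based d.
have nuv : pi p != pi q by rewrite (inj_eq perm_inj) ord_eqE; lia.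
have := grow a (pi p) (or_introl sa); have := grow a' (pi q) (or_intror sa').
clear -ends nuv adj h1 h2 h3 h4 lt_q eq_q.
move=> /(_ (esym h1)) gq /(_ (esym h2)) gp.
have {}gq := gq ltac:(lia); have {}gp := gp ltac:(lia).
by clear -ends nuv adj gq gp lt_q eq_q; based d.
Qed.

Lemma follows_switch l pi tau : switch pi tau -> follows l pi = follows l tau.
Proof.
case/and3P => hpi htau /existsP[p /existsP[q /and3P[/eqP eq_q adj /eqP etau]]].
rewrite etau in htau *; have ends := switch_ends eq_q adj hpi htau.
have lt_q := ltn_ord q; apply: eq_forallb => j; rewrite starts_switch //.
by have := ltn_ord j; lia.
Qed.

Lemma follows_connect l pi tau : connect (@switch n) pi tau -> follows l pi = follows l tau.
Proof.
case/connectP => s; elim: s pi => [|sigma s IH] pi /=; first by move=> _ ->.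
by case/andP => /(follows_switch l) -> /IH.
Qed.

Lemma place_follows l pi tau b k : follows l pi -> follows l tau ->
  0 < k < n.-2 -> (place pi b <= k) = (place tau b <= k).
Proof.
move=> /forallP fp /forallP ft lt_k.
have ek : k = (label k.-1).+1 by rewrite labelK; lia.
have := startsP _ _ _ (fp (label k.-1)) b; have := startsP _ _ _ (ft (label k.-1)) b.
by rewrite -ek => -> ->.
Qed.

Lemma switch_end pi p q : pi \in arc_perms n -> q = p.+1 :> nat ->
  (p == 0 :> nat) || (p == n.-2 :> nat) -> switch pi (tperm p q * pi)%g.
Proof.
move=> hpi eq_q ends; have /arc_permP h := hpi.
apply/and3P; split=> //.
  apply/arc_permP => k lt_k; case: (eqVneq k p) => [ek|nkp].
    by apply: starts_trivial => //; rewrite ek; case/orP: ends => ->; rewrite ?orbT.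
  by have [a sa] := h k lt_k; exists a; rewrite starts_switch.
apply/existsP; exists p; apply/existsP; exists q; rewrite eq_q !eqxx andbT /=.
have npq : pi p != pi q by rewrite (inj_eq perm_inj) ord_eqE; lia.
have lt_q := ltn_ord q.
case/orP: ends => /eqP ep.
  have [a /startsP sa] := h 1 ltac:(lia).
  have := sa (pi p); have := sa (pi q); rewrite !place_perm eq_q ep /=.
  by move=> /esym h1 /esym h2; clear -h1 h2 npq; based a.
have [a /startsP sa] := h (n - 3) ltac:(lia).
have := sa (pi p); have := sa (pi q); rewrite !place_perm eq_q ep.
have -> : (n.-2.+1 <= n - 3) = false by lia.
have -> : (n.-2 <= n - 3) = false by lia.
by move=> /esym h1 /esym h2; clear -h1 h2 npq; based a.
Qed.

(** The only freedom left by the intervals of sizes from [2] to [n - 2] is the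
    order of the first two letters and that of the last two. Each of these
    orders is corrected by at most one switch. *)
Lemma connect_follows l pi tau : pi \in arc_perms n -> tau \in arc_perms n ->
  follows l pi -> follows l tau -> connect (@switch n) pi tau.
Proof.
move=> hpi htau fpi ftau.
have align sigma p q r : sigma \in arc_perms n -> follows l sigma ->
    q = p.+1 :> nat -> (p == 0 :> nat) || (p == n.-2 :> nat) ->
    place sigma (tau r) = p \/ place sigma (tau r) = q -> r = p \/ r = q ->
    exists rho, [/\ connect (@switch n) sigma rho, rho \in arc_perms n,
      follows l rho, rho r = tau r & forall s, s != p -> s != q -> rho s = sigma s].
  move=> hs fs eq_q ends.
  have sigmaE (s : 'I_n) : place sigma (tau r) = s :> nat -> sigma s = tau r.
    by move=> /ord_inj <-; rewrite permKV.
  have sw := switch_end hs eq_q ends.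
  have := sw => /and3P[_ hrho _].
  have frho : follows l (tperm p q * sigma)%g by rewrite -(follows_switch l sw).
  case=> /sigmaE e -[er|er]; subst r.
  - by exists sigma; split.
  - exists (tperm p q * sigma)%g; split; rewrite ?permM ?tpermR ?connect1 // => s.
    by move=> nsp nsq; rewrite permM tpermD // eq_sym.
  - exists (tperm p q * sigma)%g; split; rewrite ?permM ?tpermL ?connect1 // => s.
    by move=> nsp nsq; rewrite permM tpermD // eq_sym.
  - by exists sigma; split.
have lt0 : 0 < n by lia. have lt1 : 1 < n by lia.
have lt2 : n.-2 < n by lia. have lt3 : n.-1 < n by lia.
pose p0 := Ordinal lt0; pose p1 := Ordinal lt1; pose p2 := Ordinal lt2; pose p3 := Ordinal lt3.
have [sigma [c1 hs fs e0 _]] : exists rho, [/\ connect (@switch n) pi rho, rho \in arc_perms n,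
      follows l rho, rho p0 = tau p0 & forall s, s != p0 -> s != p1 -> rho s = pi s].
  apply: align; rewrite ?eqxx //; last by left.
  have := place_follows (tau p0) (k := 1) fpi ftau ltac:(lia).
  by rewrite (place_perm tau) /=; lia.
have [rho [c2 hr fr e3 e]] : exists rho, [/\ connect (@switch n) sigma rho, rho \in arc_perms n,
      follows l rho, rho p3 = tau p3 & forall s, s != p2 -> s != p3 -> rho s = sigma s].
  apply: align; rewrite ?eqxx ?orbT //=; [lia| |by right].
  have := place_follows (tau p3) (k := n - 3) fs ftau ltac:(lia).
  by rewrite (place_perm tau) /=; have := place_lt sigma (tau p3); lia.
apply: (connect_trans c1); suff <- : rho = tau by [].
rewrite -e in e0; [|by rewrite ord_eqE /=; clear -n_gt4; lia..].
have places b : place rho b = place tau b.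
  have h k := place_follows b (k := k) fr ftau.
  have first : (place rho b == 0) = (place tau b == 0).
    rewrite -[0]/(nat_of_ord p0) -{1}(place_perm rho p0) -(place_perm tau p0).
    by rewrite !(inj_eq (@place_inj _)) e0.
  have last : (place rho b == n.-1) = (place tau b == n.-1).
    rewrite -[n.-1]/(nat_of_ord p3) -{1}(place_perm rho p3) -(place_perm tau p3).
    by rewrite !(inj_eq (@place_inj _)) e3.
  have := place_lt rho b; have := place_lt tau b.
  have := h (place rho b); have := h (place rho b).-1; have := h 1; have := h (n - 3).
  by move: first last; clear -n_gt4; lia.
apply/permP => s; apply: (@perm_inj _ rho^-1%g); apply: ord_inj.
by rewrite -!/(place _ _) place_perm places place_perm.
Qed.

(** The growing intervals determine the letters: the letter at place [k] is
    the end by which the [k]-th interval exceeds the previous one. *)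
Lemma starts_realize (L : nat -> 'I_n) :
  (forall k, k.+1 < n -> L k.+1 = L k \/ L k = ordS (L k.+1)) ->
  exists pi, forall k, k < n -> starts pi k (L k).
Proof.
move=> step.
pose new k := if k is k'.+1 then if L k == L k' then turn (L k) k else L k else L 0.
have onto k : k < n -> forall b, off (L k) b <= k -> exists2 r, r <= k & new r = b.
  elim: k => [|k IH] lt_k b le_b.
    by exists 0 => //=; clear -le_b; based (L 0).
  have le_IH : off (L k) b <= k -> exists2 r, r <= k.+1 & new r = b.
    by move=> /(IH (ltnW lt_k))[r le_r]; exists r; rewrite // leqW.
  case: (boolP (off (L k) b <= k)) => [/le_IH//|out].
  exists k.+1 => //=; case: eqP => [e|ne].
    by rewrite -e in out; clear -out le_b lt_k; based (L k.+1).
  case: (step k lt_k) => // e; have := off_off_spec (L k.+1) (L k) b.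
  by move: e; clear -out le_b lt_k; based (L k.+1).
have into k : k < n -> forall r, r <= k -> off (L k) (new r) <= k.
  elim: k => [|k IH] lt_k r.
    by rewrite leqn0 => /eqP->; rewrite off0.
  rewrite leq_eqVlt ltnS => /orP[/eqP->|/(IH (ltnW lt_k))] /=.
    by case: eqP => [e|_]; rewrite ?off0 // off_turn.
  set b := new r; have := off_off_spec (L k.+1) (L k) b.
  by case: (step k lt_k) => e; [rewrite -e|move: e]; clear -lt_k; based (L k.+1).
have /fin_all_exists[g gK] : forall b : 'I_n, exists r : 'I_n, new r = b.
  move=> b; have lt_last : n.-1 < n by have := ltn_ord b; lia.
  have [|r le_r <-] := onto _ lt_last b; first by have := off_lt (L n.-1) b; lia.
  have lt_r : r < n by lia.
  by exists (Ordinal lt_r).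
have new_inj : injective (fun r : 'I_n => new r).
  exact: (can_inj (canF_sym (f := g) (g := fun r : 'I_n => new r) gK)).
exists (perm new_inj) => k lt_k; apply/startsP => b.
have e : new (place (perm new_inj) b) = b.
  by have := permKV (perm new_inj) b; rewrite permE.
apply/idP/idP => [le_k|/(onto k lt_k)[r le_r]].
  by rewrite -{1}e into.
have lt_r : r < n by lia.
rewrite -{1}e => /(@new_inj (Ordinal lt_r)) er.
by rewrite /place -er.
Qed.

End ArcPermutations.

(** * Pairs of letters in opposite order *)

Section Inversions.
Variable n : nat.
Hypothesis n_gt4 : 4 < n.

Implicit Types (l m : {ffun 'I_(n - 3) -> 'I_n}) (i j : 'I_(n - 3)).
Implicit Types (pi tau : 'S_n) (a b x y u v w p q : 'I_n) (k : nat).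
Notation label := (label n_gt4).

Definition inverted pi tau a b : bool :=
  [&& K'_edge a b, place pi a < place pi b & place tau b < place tau a].

Definition single_inversion pi tau : Prop :=
  exists a b, inverted pi tau a b /\
    forall u v, inverted pi tau u v -> u = a /\ v = b.

Lemma K'_edge_sym a b : K'_edge a b = K'_edge b a.
Proof. by rewrite /K'_edge /cyclically_adjacent eq_sym orbC. Qed.

Lemma invertedC pi tau a b : inverted pi tau a b = inverted tau pi b a.
Proof. by rewrite /inverted K'_edge_sym [(place pi a < _) && _]andbC. Qed.

Lemma single_inversion_sym pi tau : single_inversion pi tau -> single_inversion tau pi.
Proof.
case=> a [b [iab uniq_ab]]; exists b, a; split=> [|u v]; first by rewrite -invertedC.
by rewrite -invertedC => /uniq_ab[-> ->].
Qed.

(** The staircases prescribe the intervals of sizes from [2] to [n - 2]. The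
    intervals of sizes [1] and [n - 1] are chosen equal for both permutations:
    the first element of [l] begins the former, the last one of [m] the latter.
    Then all intervals agree but one, and the only letters in opposite order
    are those by which the two intervals at this place differ. *)
Lemma lower_realize l m i : staircase l -> staircase m ->
  (forall j, j != i -> l j = m j) -> l i = ordS (m i) ->
  exists pi tau, [/\ pi \in arc_perms n, tau \in arc_perms n, follows l pi, follows m tau
    & single_inversion pi tau].
Proof.
move=> sl sm e step.
have near j : l j = m j \/ l j = ordS (m j).
  by case: (eqVneq j i) => [->|/e]; [right|left].
pose L k := if k < n.-2 then l (label k.-1) else m (label (n - 4)).
pose M k := if k == 0 then l (label 0) else if k < n.-2 then m (label k.-1) else m (label (n - 4)).
have lt_i := ltn_ord i.
have stepE (g : {ffun 'I_(n - 3) -> 'I_n}) k : staircase g -> 0 < k -> k.+1 < n.-2 ->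
    g (label k) = g (label k.-1) \/ g (label k.-1) = ordS (g (label k)).
  move=> sg k_gt0 lt_k; apply: (staircase_step sg); rewrite !labelK; lia.
have [|pi hpi] := @starts_realize n n_gt4 L.
  move=> k lt_k; rewrite /L; case: (ltnP k.+1 n.-2) => h1 /=.
    rewrite (ltnW h1); case: k {lt_k} h1 => [|k] h1; first by left.
    exact: stepE.
  case: ltnP => h2; last by left.
  have -> : k.-1 = n - 4 by lia.
  by case: (near (label (n - 4))) => ->; [left|right].
have [|tau htau] := @starts_realize n n_gt4 M.
  move=> k lt_k; rewrite /M /=; case: k lt_k => [|k] lt_k /=.
    have -> : 1 < n.-2 by lia.
    by case: (near (label 0)) => ->; [left|right].
  case: (ltnP k.+2 n.-2) => h1.
    by rewrite (ltnW h1); exact: stepE.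
  case: ltnP => h2; last by left.
  by left; congr (m (label _)); lia.
have LM k : k != i.+1 -> L k = M k.
  move=> nk; rewrite /L /M; case: eqP => [->|/eqP k0]; first by rewrite (_ : 0 < n.-2) //; lia.
  case: ifP => // lt_k; apply: e; rewrite ord_eqE labelK; lia.
have lt_i2 : i.+1 < n.-2 by lia.
have Li : L i.+1 = l i by rewrite /L lt_i2 /= label_val.
have Mi : M i.+1 = m i by rewrite /M lt_i2 /= label_val.
exists pi, tau; split.
- by apply/arc_permP => k lt_k; exists (L k); apply: hpi.
- by apply/arc_permP => k lt_k; exists (M k); apply: htau.
- apply/forallP => j; have lt_j := ltn_ord j; have := hpi j.+1 ltac:(lia).
  by rewrite /L label_val (_ : j.+1 < n.-2) //; lia.
- apply/forallP => j; have lt_j := ltn_ord j; have := htau j.+1 ltac:(lia).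
  by rewrite /M label_val (_ : j.+1 < n.-2) //; lia.
have /startsP := hpi i.+1 ltac:(lia); have /startsP := htau i.+1 ltac:(lia).
rewrite Li Mi; set y := m i in step *; set x := l i in step * => starts_tau starts_pi.
exists (turn x i.+1), y; split.
  apply/and3P; split.
  - by clear -lt_i step n_gt4; based y.
  - apply: (@leq_ltn_trans i.+1); first by rewrite starts_pi off_turn //; lia.
    by rewrite ltnNge starts_pi; have := off_off_spec y x y; clear -lt_i step n_gt4; based y.
  - apply: (@leq_ltn_trans i.+1); first by rewrite starts_tau off0.
    by rewrite ltnNge starts_tau; clear -lt_i step n_gt4; based y.
move=> u v /and3P[_ pi_uv tau_vu].
(* Only the intervals at index [i.+1] tell the order of an inverted pair. *)
have ku : place pi u = i.+1.
  apply/eqP; apply: contraT => nk; have lt_k := place_lt pi u.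
  have /startsP s1 := hpi _ lt_k; have /startsP s2 := htau _ lt_k.
  have := s1 u; have := s1 v; rewrite (LM _ nk) -!s2.
  by move: pi_uv tau_vu; clear; lia.
have kv : place tau v = i.+1.
  apply/eqP; apply: contraT => nk; have lt_k := place_lt tau v.
  have /startsP s1 := hpi _ lt_k; have /startsP s2 := htau _ lt_k.
  have := s1 u; have := s1 v; rewrite (LM _ nk) -!s2.
  by move: pi_uv tau_vu; clear; lia.
have := starts_pi u; have := starts_pi v; have := starts_tau u; have := starts_tau v.
rewrite ku kv; move: pi_uv tau_vu; rewrite ku kv => lt1 lt2.
have -> : (place pi v <= i.+1) = false by lia.
have -> : (place tau u <= i.+1) = false by lia.
have := off_off_spec y x u; have := off_off_spec y x v; rewrite leqnn.
clear -step lt_i => o1 o2 /esym h1 /esym h2 /esym h3 /esym h4.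
by split; based y.
Qed.

Lemma differ_once_realize l m : staircase l -> staircase m -> differ_once l m ->
  exists pi tau, [/\ pi \in arc_perms n, tau \in arc_perms n, follows l pi, follows m tau
    & single_inversion pi tau].
Proof.
move=> sl sm [i [ni e]].
case: (differ_once_step n_gt4 sl sm ni e) => -[st _ _].
  exact: lower_realize sl sm e st.
have e' j : j != i -> m j = l j by move/e.
have [tau [pi [ht hp ft fp s]]] := lower_realize sm sl e' st.
by exists pi, tau; split=> //; apply: single_inversion_sym.
Qed.

(** Two arcs of the same size that are not shifts of each other by one step
    have at least two pairs of letters that are not cyclically adjacent and
    appear in opposite order. *)
Lemma arcs_exchange x y k a b : 0 < k < n.-2 -> x != y ->
  (forall u v, off x u <= k -> k < off x v -> off y v <= k -> k < off y u ->
     K'_edge u v -> u = a /\ v = b) ->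
  [/\ x = a, y = ordS a & b = turn a k.+1] \/ [/\ y = b, x = ordS b & a = turn b k.+1].
Proof.
move=> lt_k nxy uniq_ab; set s := off x y.
have lt_s : s < n by apply: off_lt.
have s_gt0 : 0 < s by rewrite /s; clear -nxy; based x.
have H c d : c <= k -> k < d < n -> c + 1 < d < c + n.-1 ->
    (s <= d) && (d - s <= k) || (d < s) && (d + n - s <= k) ->
    (s <= c) && (k < c - s) || (c < s) && (k < c + n - s) ->
    turn x c = a /\ turn x d = b.
  move=> le_c lt_d K h1 h2; have := off_off_spec x y (turn x c).
  have := off_off_spec x y (turn x d).
  rewrite -/s !off_turn; [|clear -le_c lt_d; lia..] => o1 o2.
  apply: uniq_ab; rewrite ?off_turn //; try (clear -le_c lt_d lt_k o1 o2 h1 h2 lt_s; lia).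
  by clear -le_c lt_d K; based x.
have two c d c' d' : turn x c = a /\ turn x d = b -> turn x c' = a /\ turn x d' = b ->
    c < n -> d < n -> c' < n -> d' < n -> c = c' /\ d = d'.
  move=> [<- <-] [e1 e2] *.
  by split; apply: (turn_inj (a := x)).
have [s1|ns1] := eqVneq s 1.
  left; have [<- <-] := H 0 k.+1 ltac:(lia) ltac:(lia) ltac:(lia) ltac:(lia) ltac:(lia).
  by rewrite /s in s1; split=> //; clear -s1; based x.
have [sn|nsn] := eqVneq s n.-1.
  right; have [<- <-] := H k n.-1 ltac:(lia) ltac:(lia) ltac:(lia) ltac:(lia) ltac:(lia).
  by rewrite /s in sn; split=> //; clear -sn lt_k; based x.
(* The arcs consist of the offsets [0] to [k] and [s] to [s + k] from [x]; the
   four cases are whether either of them contains the first point of the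
   other. Each provides two pairs with the required property. *)
exfalso; case: (leqP s k) => h1; case: (ltnP (s + k) n) => h2.
- have h3 := H 0 k.+1 ltac:(lia) ltac:(lia) ltac:(lia) ltac:(lia) ltac:(lia).
  have h4 := H 1 k.+1 ltac:(lia) ltac:(lia) ltac:(lia) ltac:(lia) ltac:(lia).
  have := two _ _ _ _ h3 h4; clear -lt_k; lia.
- have h3 := H s.-1 n.-1 ltac:(lia) ltac:(lia) ltac:(lia) ltac:(lia) ltac:(lia).
  have h4 := H s.-2 n.-2 ltac:(lia) ltac:(lia) ltac:(lia) ltac:(lia) ltac:(lia).
  have := two _ _ _ _ h3 h4; clear -lt_k lt_s s_gt0; lia.
- have h3 := H 0 s ltac:(lia) ltac:(lia) ltac:(lia) ltac:(lia) ltac:(lia).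
  have h4 := H 1 s.+1 ltac:(lia) ltac:(lia) ltac:(lia) ltac:(lia) ltac:(lia).
  have := two _ _ _ _ h3 h4; clear -lt_k lt_s nsn; lia.
- have h3 := H k n.-1 ltac:(lia) ltac:(lia) ltac:(lia) ltac:(lia) ltac:(lia).
  have h4 := H k.-1 n.-1 ltac:(lia) ltac:(lia) ltac:(lia) ltac:(lia) ltac:(lia).
  have := two _ _ _ _ h3 h4; clear -lt_k; lia.
Qed.

(** Equivalent permutations only disagree on the order of the first two and of
    the last two letters, which are cyclically adjacent. *)
Lemma follows_no_inversion l pi tau a b : pi \in arc_perms n ->
  follows l pi -> follows l tau -> ~~ inverted pi tau a b.
Proof.
move=> /arc_permP hpi fp ft; apply/negP => /and3P[/andP[nab nadj] pi_ab tau_ba].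
have same c k := @place_follows n n_gt4 l pi tau c k fp ft.
have := same a (place pi a); have := same b (place pi a).
have := same a 1; have := same b 1.
have lb := place_lt pi b; case: (posnP (place pi a)) => a0.
  have [eb|nb] := eqVneq (place pi b) 1; last by move: a0 pi_ab tau_ba nb; clear -n_gt4; lia.
  have [d /startsP sd] := hpi 1 ltac:(lia).
  have := sd a; have := sd b; rewrite eb a0 => /esym h1 /esym h2 _ _ _ _.
  by move/negP: nadj; apply; clear -h1 h2 nab; based d.
have [ea|na] := eqVneq (place pi a) n.-2; last by move: a0 na lb pi_ab tau_ba; clear; lia.
have [d /startsP sd] := hpi (n - 3) ltac:(lia).
have := sd a; have := sd b.
have -> : (place pi a <= n - 3) = false by lia.
have -> : (place pi b <= n - 3) = false by lia.
move=> /esym h1 /esym h2 _ _ _ _.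
by move/negP: nadj; apply; clear -h1 h2 nab; based d.
Qed.

(** At each step where the staircases differ, [arcs_exchange] expresses the
    lengths and ends of the two intervals by the only inverted pair. Two such
    steps either have the same length or belong to intervals that are
    complementary up to their ends, and the latter are not nested. *)
Lemma single_inversion_differ l m pi tau : pi \in arc_perms n ->
  staircase l -> staircase m -> follows l pi -> follows m tau ->
  single_inversion pi tau -> differ_once l m.
Proof.
move=> hpi sl sm fp ft [a [b [iab uniq_ab]]].
have key j : l j != m j ->
    [/\ l j = a, m j = ordS a & b = turn a j.+2] \/
    [/\ m j = b, l j = ordS b & a = turn b j.+2].
  move=> nj; have lt_j := ltn_ord j; apply: arcs_exchange => //; first by lia.
  have /startsP sp := forallP fp j; have /startsP st := forallP ft j.
  move=> u v; rewrite -!sp -!st => h1; rewrite ltnNge -sp => h2 h3.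
  rewrite ltnNge -st => h4 K; apply: uniq_ab; rewrite /inverted K /=.
  by move: h1 h2 h3 h4; clear; lia.
have [i ni] : exists i, l i != m i.
  apply/existsP; apply: contraT; rewrite negb_exists => /forallP same.
  have e : l = m by apply/ffunP => j; apply/eqP; rewrite -[_ == _]negbK same.
  by rewrite -e in ft; case/negP: (follows_no_inversion a b hpi fp ft).
have lone j j' : l j != m j -> l j' != m j' -> j <= j' -> j = j'.
  move=> nj nj' le; apply: ord_inj; have lt_j := ltn_ord j; have lt_j' := ltn_ord j'.
  have lel := staircase_le n_gt4 sl le; have lem := staircase_le n_gt4 sm le.
  case: (key _ nj) => -[e1 e2 e3]; case: (key _ nj') => -[e1' e2' e3'].
  - have := e3'; rewrite e3 => /(@turn_inj _ a); clear -lt_j lt_j'; lia.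
  - rewrite e2 e1' in lem; exfalso.
    by clear -lem e3' e3 lt_j lt_j' le; based b.
  - rewrite e2 e1' in lel; exfalso.
    by clear -lel e3' e3 lt_j lt_j' le; based a.
  - have := e3'; rewrite e3 => /(@turn_inj _ b); clear -lt_j lt_j'; lia.
exists i; split=> // j nji; apply/eqP; apply: contraT => nj; case/eqP: nji.
by case: (leqP j i) => [|/ltnW] le; [|apply/esym]; apply: lone.
Qed.

Definition stair_class l : {set 'S_n} :=
  [set pi in arc_perms n | follows l pi]%SET.

Lemma stair_class_arc l : staircase l -> stair_class l \in arc_classes n.
Proof.
move=> sl; have lt0 : 0 < n - 3 by lia.
pose L k := l (label (minn k.-1 (n - 4))).
have [|pi hpi] := @starts_realize n n_gt4 L.
  move=> k lt_k; rewrite /L /=; case: (posnP k) => [->|k_gt0]; first by left.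
  case: (leqP k (n - 4)) => h; last by left; congr (l (label _)); lia.
  have -> : minn k.-1 (n - 4) = k.-1 by lia.
  by apply: (staircase_step sl); rewrite !labelK; lia.
have pi_arc : pi \in arc_perms n.
  by apply/arc_permP => k lt_k; exists (L k); apply: hpi.
have pi_l : follows l pi.
  apply/forallP => j; have lt_j := ltn_ord j; have := hpi j.+1 ltac:(lia).
  rewrite /L /= (_ : minn j (n - 4) = j) ?label_val //; lia.
apply/imsetP; exists pi => //; apply/setP => tau; rewrite [LHS]finset.in_set [RHS]finset.in_set.
case: (boolP (tau \in arc_perms n)) => //= tau_arc; apply/idP/idP => h.
  exact: (connect_follows n_gt4 pi_arc tau_arc pi_l h).
by rewrite -(follows_connect n_gt4 l h).
Qed.

Lemma arc_class_stair A : A \in arc_classes n -> exists2 l, staircase l & stair_class l = A.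
Proof.
case/imsetP => pi pi_arc ->; have [l pi_l] := follows_exists n_gt4 pi_arc.
exists l; first exact: (follows_staircase n_gt4 pi_l).
apply/setP => tau; rewrite [LHS]finset.in_set [RHS]finset.in_set.
case: (boolP (tau \in arc_perms n)) => //= tau_arc; apply/idP/idP => h.
  exact: (connect_follows n_gt4 pi_arc tau_arc pi_l h).
by rewrite -(follows_connect n_gt4 l h).
Qed.

Lemma stair_class_inj l m : staircase l -> stair_class l = stair_class m -> l = m.
Proof.
move=> sl e; have : stair_class l \in arc_classes n by apply: stair_class_arc.
case/imsetP => pi pi_arc epi.
have pl : pi \in stair_class l by rewrite epi finset.in_set pi_arc connect0.
have pm := pl; rewrite e in pm.
rewrite finset.in_set in pl; rewrite finset.in_set in pm.
by case/andP: pl => _ pl; case/andP: pm => _ /(follows_uniq n_gt4 pl).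
Qed.

End Inversions.

(** * Chambers *)

Section Chambers.
Import Order.TTheory GRing.Theory Num.Theory.
Import numFieldNormedType.Exports.
Local Open Scope classical_set_scope.
Local Open Scope ring_scope.
Variables (R : realType) (n : nat).
Implicit Types (pi tau : 'S_n) (i j a b u v : 'I_n) (x y z : 'rV[R]_n).

Notation Omega := (@arrangement_complement R n).
Notation hyp := (@hyperplane R n).

Lemma complementP x : Omega x <->
  sum_zero x /\ forall i j, K'_edge i j -> x 0 i != x 0 j.
Proof.
split=> -[x0 h]; split=> //.
  move=> i j ij; apply/eqP => e.
  by apply: (h (hyp i j)); first by exists i, j.
by move=> H [i [j [ij ->]]] [_ e]; have := h _ _ ij; rewrite e eqxx.
Qed.

Definition cell x : set 'rV[R]_n :=
  [set y | Omega y /\ forall i j, K'_edge i j -> x 0 i < x 0 j -> y 0 i < y 0 j].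

(** On a connected subset of the complement a difference of coordinates cannot
    change its sign without vanishing; conversely, a cell is convex. *)
Lemma component_cell x : Omega x -> connected_component Omega x = cell x.
Proof.
move=> Ox; apply/seteqP; split=> y.
- case=> B [Bx BO Bc] By; split=> [|i j ij lt_x]; first exact: BO.
  rewrite ltNge; apply/negP => le_y.
  pose g := fun z : 'rV[R]_n => z 0 j - z 0 i.
  have g_cont : continuous g.
    by move=> z; apply: continuousB; apply: coord_continuous.
  have : connected (g @` B).
    by apply: connected_continuous_connected => //; apply: continuous_subspaceT.
  move/connected_intervalP => itv.
  have [|z Bz] := itv (g y) (g x) (imageP g By) (imageP g Bx) 0.
    by rewrite /g subr_le0 le_y subr_ge0 ltW.
  move=> /eqP; rewrite /g subr_eq0 => /eqP e.
  by have /complementP[_ /(_ _ _ ij)] := BO _ Bz; rewrite e eqxx.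
- case=> Oy same; have /complementP[x0 xne] := Ox; have /complementP[y0 yne] := Oy.
  pose g := fun t : R => x + t *: (y - x).
  have g_cont : continuous g.
    by move=> t; exact: (cvgD (cvg_cst x) (@scalel_continuous _ _ (y - x) t)).
  exists (g @` `[0, 1]).
    split.
    + by exists 0; rewrite /g ?scale0r ?addr0 //= in_itv /= lexx ler01.
    + move=> z [t]; rewrite /= in_itv /= => /andP[t0 t1] <-.
      have gE k : g t 0 k = (1 - t) * x 0 k + t * y 0 k.
        by rewrite /g !mxE; ring.
      have lt_g a b : x 0 a < x 0 b -> y 0 a < y 0 b -> g t 0 a < g t 0 b.
        rewrite !gE -subr_gt0 -[y 0 a < _]subr_gt0 => lx ly; rewrite -subr_gt0.
        have -> : (1 - t) * x 0 b + t * y 0 b - ((1 - t) * x 0 a + t * y 0 a)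
          = (1 - t) * (x 0 b - x 0 a) + t * (y 0 b - y 0 a) by ring.
        have [t_0|t_neq0] := eqVneq t 0; first by rewrite t_0; lra.
        have t_gt0 : 0 < t by rewrite lt_neqAle eq_sym t_neq0.
        apply: ltr_wpDl; last exact: mulr_gt0.
        by apply: mulr_ge0; [rewrite subr_ge0|exact: ltW].
      apply/complementP; split=> [|i j ij].
        rewrite /sum_zero /= (eq_bigr _ (fun k _ => gE k)) big_split /=.
        by rewrite -!mulr_sumr x0 y0 !mulr0 addr0.
      have := xne _ _ ij; rewrite neq_lt => /orP[lt_ij|lt_ji].
        by rewrite lt_eqF // lt_g // same.
      by rewrite gt_eqF // lt_g // same // K'_edge_sym.
    + apply: connected_continuous_connected; first exact: segment_connected.
      exact: continuous_subspaceT.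
  by exists 1; rewrite /g ?scale1r ?subrKC //= in_itv /= lexx ler01.
Qed.

(** The places in [pi], rescaled and shifted so that their sum is zero. *)
Definition witness pi : 'rV[R]_n :=
  \row_a (n%:R * (place pi a)%:R - \sum_b (place pi b)%:R).

Lemma witness_lt pi a b : (witness pi 0 a < witness pi 0 b) = (place pi a < place pi b)%N.
Proof.
have n_gt0 : (0 < n)%N by apply: leq_ltn_trans (ltn_ord a).
by rewrite !mxE ltrD2r ltr_pM2l ?ltr0n // ltr_nat.
Qed.

Lemma witness_sum pi : sum_zero (witness pi).
Proof.
rewrite /sum_zero /= (eq_bigr (fun a => n%:R * (place pi a)%:R - \sum_b (place pi b)%:R)).
  by rewrite big_split /= -mulr_sumr mulr_natl sumr_const card_ord mulNrn subrr.
by move=> a _; rewrite mxE.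
Qed.

Lemma cone_lt pi y a b : cone pi y -> (place pi a < place pi b)%N -> y 0 a < y 0 b.
Proof. by case=> _ h /h; rewrite !permKV. Qed.

Lemma witness_cone pi : cone pi (witness pi).
Proof.
by split=> [|k l lt_kl]; [exact: witness_sum|rewrite witness_lt !place_perm].
Qed.

Lemma cone_complement pi : cone pi `<=` Omega.
Proof.
move=> y cy; apply/complementP; split=> [|i j /andP[nij _]]; first by case: cy.
have : place pi i != place pi j by rewrite (inj_eq (@place_inj _ pi)).
by rewrite neq_ltn => /orP[] /(cone_lt cy) h; rewrite ?(lt_eqF h) ?(gt_eqF h).
Qed.

Lemma cone_cell pi : cone pi `<=` cell (witness pi).
Proof.
move=> y cy; split=> [|i j _]; first exact: cone_complement cy.
by rewrite witness_lt; apply: cone_lt.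
Qed.

Lemma witness_complement pi : Omega (witness pi).
Proof. exact: cone_complement (witness_cone pi). Qed.

Lemma chamber_of_cone pi C : chamber C /\ cone pi `<=` C <-> C = cell (witness pi).
Proof.
have Ow := witness_complement pi.
split=> [[[x Ox ->]] sub|->].
  rewrite -component_cell //; apply: same_connected_component.
  exact/sub/witness_cone.
split; last exact: cone_cell.
by exists (witness pi); rewrite ?component_cell.
Qed.

Lemma hyperplaneC i j : hyp i j = hyp j i.
Proof. by apply/seteqP; split=> x [x0 e]. Qed.

(** The vector with entries [1] at [i] and [j] and [-2] at a third index lies on
    the hyperplane of [i] and [j], but on no hyperplane that involves this third
    index. *)
Lemma hyperplane_inj i j u v : u != v -> hyp i j = hyp u v ->
  (u = i /\ v = j) \/ (u = j /\ v = i).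
Proof.
have inside u' v' : u' != v' -> hyp i j = hyp u' v' -> (u' == i) || (u' == j).
  move=> nuv e; apply: contraT; rewrite negb_or => /andP[nui nuj].
  pose x : 'rV[R]_n := \row_a ((a == i)%:R + (a == j)%:R - 2 * (a == u')%:R).
  have delta b : \sum_a (a == b)%:R = 1 :> R.
    by rewrite (bigD1 b) //= eqxx big1 ?addr0 // => a /negbTE->.
  have : hyp i j x.
    split.
      rewrite /sum_zero /= (eq_bigr (fun a => (a == i)%:R + (a == j)%:R - 2 * (a == u')%:R)).
        by rewrite !big_split /= sumrN -mulr_sumr !delta; ring.
      by move=> a _; rewrite mxE.
    rewrite !mxE !eqxx ![_ == u']eq_sym (negbTE nui) (negbTE nuj) (eq_sym j i).
    by ring.
  rewrite e => -[_]; rewrite !mxE eqxx (negbTE nui) (negbTE nuj) [v' == u']eq_sym (negbTE nuv).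
  by case: (v' == i); case: (v' == j) => /=; lra.
move=> nuv e; have nvu : v != u by rewrite eq_sym.
case/orP: (inside _ _ nuv e) => /eqP eu;
  case/orP: (inside _ _ nvu (etrans e (hyperplaneC u v))) => /eqP ev.
- by rewrite eu ev eqxx in nuv.
- by left.
- by right.
- by rewrite eu ev eqxx in nuv.
Qed.

Lemma separates_inverted pi tau H :
  arrangement H /\ separates H (cell (witness pi)) (cell (witness tau)) <->
  exists a b, H = hyp a b /\ inverted pi tau a b.
Proof.
split=> [[[u [v [uv eH]]] [a [b [eH' Cab Dba]]]]|[a [b [-> /and3P[ab piab tauba]]]]].
  exists a, b; split=> //.
  have [_] := Cab _ (cone_cell (witness_cone pi)); rewrite witness_lt => piab.
  have [_] := Dba _ (cone_cell (witness_cone tau)); rewrite witness_lt => tauba.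
  apply/and3P; split=> //.
  have nuv : u != v by have /andP[] := uv.
  by have [[<- <-]|[<- <-]] := hyperplane_inj nuv (etrans (esym eH') eH); rewrite // K'_edge_sym.
split; first by exists a, b.
exists a, b; split=> // y [Oy h]; have /complementP[y0 _] := Oy; split=> //.
  by apply: h; rewrite ?witness_lt.
by apply: h; rewrite ?witness_lt // K'_edge_sym.
Qed.

Lemma lie_in_adjacent_chambersP pi tau :
  lie_in_adjacent_chambers R pi tau <-> single_inversion pi tau.
Proof.
transitivity (adjacent_chambers (cell (witness pi)) (cell (witness tau))).
  split=> [[C [D [cC cD sC sD adj]]]|adj].
    have -> : cell (witness pi) = C by apply/esym/chamber_of_cone.
    by have -> : cell (witness tau) = D by apply/esym/chamber_of_cone.
  have [cC sC] := (chamber_of_cone pi _).2 erefl.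
  have [cD sD] := (chamber_of_cone tau _).2 erefl.
  by exists (cell (witness pi)), (cell (witness tau)).
split=> [[H [/separates_inverted[a [b [eH iab]]] uniqH]]|[a [b [iab uniq_ab]]]].
  exists a, b; split=> // u v iuv; have /and3P[/andP[nuv _] piuv _] := iuv.
  have /and3P[_ piab _] := iab.
  have eH' : H = hyp u v.
    by apply: uniqH; apply/separates_inverted; exists u, v.
  have [//|[eu ev]] := hyperplane_inj nuv (etrans (esym eH) eH').
  by move: piuv piab; rewrite eu ev; lia.
exists (hyp a b); split.
  by apply/separates_inverted; exists a, b.
by move=> H /separates_inverted[u [v [-> /uniq_ab[-> ->]]]].
Qed.

End Chambers.

(** * The two graph isomorphisms *)

Section Isomorphisms.
Variable n : nat.
Hypothesis n_gt4 : 4 < n.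

Definition class_vertex_of (s : staircase_type n) : class_vertex n :=
  exist (fun A => A \in arc_classes n) _ (stair_class_arc n_gt4 (valP s)).

Lemma class_vertex_of_inj : injective class_vertex_of.
Proof.
move=> s t /(congr1 val) /= e; apply: val_inj.
exact: (stair_class_inj n_gt4 (valP s) e).
Qed.

Lemma class_vertex_of_surj (A : class_vertex n) : exists s, class_vertex_of s = A.
Proof.
case: A => A hA; have [l sl e] := arc_class_stair n_gt4 hA.
by exists (exist (fun l => staircase l) l sl); apply: val_inj.
Qed.

Lemma class_vertex_of_graph (R : realType) (s t : staircase_type n) :
  stair_graph s t <-> chamber_graph R (class_vertex_of s) (class_vertex_of t).
Proof.
split=> [|[pi [tau [hpi htau /lie_in_adjacent_chambersP single]]]].
  move=> /(differ_once_realize n_gt4 (valP s) (valP t))[pi [tau [hp ht fp ft single]]].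
  exists pi, tau; split; [exact/setIdP|exact/setIdP|].
  exact/lie_in_adjacent_chambersP.
have /setIdP[pi_arc fp] := hpi; have /setIdP[tau_arc ft] := htau.
exact: (single_inversion_differ n_gt4 pi_arc (valP s) (valP t) fp ft single).
Qed.

Lemma graph_isomorphic_common (V V1 V2 : Type) (E : V -> V -> Prop)
    (E1 : V1 -> V1 -> Prop) (E2 : V2 -> V2 -> Prop) (f1 : V -> V1) (f2 : V -> V2) :
  injective f1 -> (forall y, exists x, f1 x = y) ->
  (forall x y, E x y <-> E1 (f1 x) (f1 y)) ->
  injective f2 -> (forall y, exists x, f2 x = y) ->
  (forall x y, E x y <-> E2 (f2 x) (f2 y)) ->
  graph_isomorphic E1 E2.
Proof.
move=> inj1 surj1 hE1 inj2 surj2 hE2.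
have [g1 g1K] := choice surj1; have [g2 g2K] := choice surj2.
exists (f2 \o g1); split.
  exists (f1 \o g2) => x /=.
    by rewrite (inj2 _ _ (g2K _)) g1K.
  by rewrite (inj1 _ _ (g1K _)) g2K.
by move=> x y; rewrite -{1}(g1K x) -{1}(g1K y) -hE1 hE2.
Qed.

End Isomorphisms.

Theorem theorem5p1 (R : realType) (n : nat) (n_gt4 : (4 < n)%N) :
  graph_isomorphic (@flip_graph n) (@chamber_graph R n).
Proof.
exact: (graph_isomorphic_common
  (@flip_vertex_of_inj n n_gt4) (flip_vertex_of_surj n_gt4)
  (flip_vertex_of_graph n_gt4)
  (@class_vertex_of_inj n n_gt4) (class_vertex_of_surj n_gt4)
  (class_vertex_of_graph n_gt4 R)).
Qed.
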